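(* Let $r$ be a rational number which is not an integer, and let $n\ge 2$ be an integer. For $s\in\hat{\mathbb{Q}}$, there is an upper-meridian-pair-preserving epimorphism from the link group $G(K(s))$ onto the even Heckoid group $\mathcal{H}(r;n)$ if and only if $s$ or $s+1$ belongs to the $\Gamma(r;n)$-orbit of $\infty$.
   Context: Notation: $\hat{\mathbb{Q}}=\mathbb{Q}\cup\{\infty\}$. The Conway sphere $\mathbb{S}$ is the 4-times punctured sphere obtained as the quotient of $\mathbb{R}^2-\mathbb{Z}^2$ by the group generated by the $\pi$-rotations about the points of $\mathbb{Z}^2$. For $s\in\hat{\mathbb{Q}}$, $\alpha_s$ denotes the simple loop on $\mathbb{S}$ obtained as the projection of a line of slope $s$. The 2-bridge link $K(s)$ is the sum of the rational tangles $(B^3,t(\infty))$ and $(B^3,t(s))$ of slopes $\infty$ and $s$, where $\partial(B^3-t(\infty))$ and $\partial(B^3-t(s))$ are identified with $\mathbb{S}$ so that $\alpha_\infty$, resp. $\alpha_s$, bounds a disk in $B^3-t(\infty)$, resp. $B^3-t(s)$. Then $\pi_1(B^3-t(\infty))$ is the free group $F(a,b)$ on the standard meridian pair $\{a,b\}$ (meridians of the two arcs of $t(\infty)$), and $G(K(s))=\pi_1(S^3-K(s))\cong\pi_1(\mathbb{S})/\langle\langle\alpha_\infty,\alpha_s\rangle\rangle\cong\pi_1(B^3-t(\infty))/\langle\langle\alpha_s\rangle\rangle$. For rational $r$ and integer $n\ge2$ the even Heckoid group is $\mathcal{H}(r;n)=\pi_1(\mathbb{S})/\langle\langle\alpha_\infty,\alpha_r^n\rangle\rangle\cong\pi_1(B^3-t(\infty))/\langle\langle\alpha_r^n\rangle\rangle$.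 The upper meridian pair of $G(K(s))$ (resp. $\mathcal{H}(r;n)$) is the image of $\{a,b\}$; an epimorphism $G(K(s))\to\mathcal{H}(r;n)$ is upper-meridian-pair-preserving if it maps the upper meridian pair of $G(K(s))$ to the upper meridian pair of $\mathcal{H}(r;n)$. Let $\mathcal{D}$ be the Farey tessellation of $\mathbb{H}^2$ with ideal vertex set $\hat{\mathbb{Q}}$; $\Gamma_\infty$ is the group generated by reflections in the Farey edges with endpoint $\infty$; $C_r(2n)$ is the group generated by the parabolic automorphism of $\mathcal{D}$ centered at $r$ moving each Farey edge incident to $r$ to the one $2n$ units away in the clockwise direction; $\Gamma(r;n)=\langle\Gamma_\infty,C_r(2n)\rangle$. *)

(* Defs.v *)
From HB Require Import structures.
From mathcomp Require Import all_boot all_order all_algebra.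
Set Implicit Arguments. Unset Strict Implicit. Unset Printing Implicit Defensive.
Import Order.TTheory GRing.Theory Num.Theory.
Local Open Scope ring_scope.

(* Q^ = Q u {oo} is modelled by [option rat], with [None] = oo.               *)

(* The Moebius action of an integral 2x2 matrix [[a,b],[c,d]] with det = +-1
   on Q^ : t |-> (a t + b)/(c t + d).  (For det = -1 this is the action of the
   corresponding orientation-reversing automorphism of the Farey tessellation,
   which on the real line Q^ is given by the same formula.) *)
Definition mob (a b c d : int) (t : option rat) : option rat :=
  match t with
  | None => if c == 0 then None else Some (a%:~R / c%:~R)
  | Some x =>
      let den := c%:~R * x + d%:~R in
      if den == 0 then None else Some ((a%:~R * x + b%:~R) / den)
  end.

(* Reflection in the Farey edge <k, oo>  (the vertical geodesic Re z = k):
   t |-> 2k - t, matrix [[-1, 2k],[0, 1]].  Gamma_oo is generated by these. *)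
Definition farey_refl (k : int) (t : option rat) : option rat :=
  mob (-1) (2 * k) 0 1 t.

(* Parabolic automorphism centred at r = q/p (p = denq r > 0, q = numq r):
   A T^m A^-1 where A = [[q,u],[p,v]] in SL(2,Z) (so A(oo) = r) and
   T = [[1,1],[0,1]]; this product equals
   [[1 - m p q, m q^2], [-m p^2, 1 + m p q]] (independent of the choice of A).
   With m = 2n it moves each Farey edge incident to r to the one 2n units
   away; it generates C_r(2n) (its inverse is the case m = -2n). *)
Definition parab (r : rat) (m : int) (t : option rat) : option rat :=
  let p := denq r in let q := numq r in
  mob (1 - m * p * q) (m * q ^+ 2) (- (m * p ^+ 2)) (1 + m * p * q) t.

Inductive GammaOrbitInf (r : rat) (n : nat) : option rat -> Prop :=
  | orb_inf : GammaOrbitInf r n None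
  | orb_refl (k : int) t : GammaOrbitInf r n t -> GammaOrbitInf r n (farey_refl k t)
  | orb_par t : GammaOrbitInf r n t -> GammaOrbitInf r n (parab r (2 * n%:Z) t)
  | orb_parV t : GammaOrbitInf r n t -> GammaOrbitInf r n (parab r (- (2 * n%:Z)) t).

Definition shift1 (s : option rat) : option rat :=
  match s with None => None | Some x => Some (x + 1) end.

Inductive gen := ga | gb.
(* A letter (g, e) stands for g if e = false, and g^-1 if e = true. *)
Definition letter := (gen * bool)%type.
Definition word := seq letter.

Definition inv_letter (x : letter) : letter := (x.1, ~~ x.2).

(* Equality in the group F(a,b)/<<rel>> : the congruence on words generated
   by free cancellation and deletion of an occurrence of the relator. *)
Inductive eqv (rel : word) : word -> word -> Prop :=
  | eqv_refl w : eqv rel w w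
  | eqv_sym u v : eqv rel u v -> eqv rel v u
  | eqv_trans u v w : eqv rel u v -> eqv rel v w -> eqv rel u w
  | eqv_free (u v : word) (x : letter) :
      eqv rel (u ++ x :: inv_letter x :: v) (u ++ v)
  | eqv_rel (u v : word) : eqv rel (u ++ rel ++ v) (u ++ v).

(* The element alpha_s of pi_1(B^3 - t(oo)) = F(a,b) represented by the
   simple loop of slope s on the Conway sphere (well defined up to
   conjugation and inversion, which does not affect <<alpha_s>>).
   For s = q/p (p > 0, gcd(p,q) = 1) it is read off from the intersections
   of a line y = (q/p) x + c (0 < c < 1/p) with the vertical lines x = k,
   k = 0, ..., 2p-1:
       alpha_{q/p} = prod_{k=0}^{2p-1} x_k^{eps_k},
       x_k = a (k even), b (k odd),  eps_k = (-1)^{floor(k q / p)}.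
   alpha_oo is the trivial element (it bounds a disk in B^3 - t(oo)). *)
Definition alpha (s : option rat) : word :=
  match s with
  | None => [::]
  | Some x =>
      let p := denq x in let q := numq x in
      mkseq (fun k : nat =>
               (if odd k then gb else ga,
                ~~ (2 %| ((k%:Z * q) %/ p)%Z)%Z)) (2 * `|p|%N)
  end.

Definition link_rel (s : option rat) : word := alpha s.
Definition heckoid_rel (r : rat) (n : nat) : word :=
  flatten (nseq n (alpha (Some r))).

Definition is_epi (R S : word) (f : word -> word) : Prop :=
  [/\ (forall u v, eqv R u v -> eqv S (f u) (f v)),
      (forall u v, eqv S (f (u ++ v)) (f u ++ f v)) &
      (forall w, exists u, eqv S (f u) w)].

(* Upper-meridian-pair-preserving: the pair of meridians {a, b} is sent to
   the pair of meridians {a, b} (meridians taken up to orientation). *)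
Definition umpp (S : word) (f : word -> word) : Prop :=
  ((exists e1, eqv S (f [:: (ga, false)]) [:: (ga, e1)]) /\
   (exists e2, eqv S (f [:: (gb, false)]) [:: (gb, e2)])) \/
  ((exists e1, eqv S (f [:: (ga, false)]) [:: (gb, e1)]) /\
   (exists e2, eqv S (f [:: (gb, false)]) [:: (ga, e2)])).

(* Main.v *)
Require Import Defs.
From HB Require Import structures.
From mathcomp Require Import all_boot all_order all_algebra.
From mathcomp Require Import zify ring.
From Stdlib Require Import Classical.
Set Implicit Arguments. Unset Strict Implicit. Unset Printing Implicit Defensive.
Import Order.TTheory GRing.Theory Num.Theory.

(** The group [F(a,b)] is realised by reduced words and acts on its Cayley tree.
An axis is a translate of the bi-infinite line reading a slope [r = q/p]; the
generators of [<<alpha_r^n>>] are the translations of [n] periods along the axes.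
Two distinct axes share fewer than [p] edges, since a common segment misses either
the letters next to the lattice points below the line ([k q = 0 mod p]) or those
next to the lattice points above it ([k q = -1 mod p]).

A windmill argument gives the analogue of Newman's spelling theorem: starting from
the base vertex one repeatedly adds to a convex set [W], invariant under the subgroup
[N], all axes that meet it. Every axis met by [W] without being contained in it meets
it along a piece, because all the words involved alternate between [a] and [b]: of
three branches of the tree at a vertex two start with letters of the same type, so
three axes cannot switch pairwise at a vertex. Hence a nontrivial alternating word of
the normal subgroup contains a segment of an axis of [n] periods less one piece.

If [alpha_s], [s = c/d], contains such a segment, then the lines of slopes [s] and [r]
stay close for a long time and [p n |p c - q d| < d], i.e. [|s - r| < 1 / (n p^2)].
In that range the parabolic element of [C_r(2n)] lowers the denominator of [s], so that a
descent shows that a trivial [alpha_s] has [s] in the orbit of infinity.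

Conversely, [alpha_s] is a product, over the strips between consecutive lines of slope
[r] through lattice points, of paths inside the strips; applying the parabolic element inserts
a conjugate of [alpha_r^n] in each strip. Finally, a meridian pair preserving
homomorphism is a signed permutation of [a] and [b], and these send [alpha_s] to a
conjugate of [alpha_s] or of [alpha_(s+1)], up to inversion. *)

(** * The free group and its tree *)

Definition bool_of_gen (g : gen) : bool := if g is ga then true else false.
Definition gen_of_bool (b : bool) : gen := if b then ga else gb.
Lemma bool_of_genK : cancel bool_of_gen gen_of_bool. Proof. by case. Qed.
HB.instance Definition _ := Countable.copy gen (can_type bool_of_genK).

Lemma inv_letterK : involutive inv_letter.
Proof. by case=> g e; rewrite /inv_letter /= negbK. Qed.

Definition no_cancel (x y : letter) := y != inv_letter x.
Definition reduced (w : word) := sorted no_cancel w.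

Lemma no_cancelC x y : no_cancel x y = no_cancel (inv_letter y) (inv_letter x).
Proof. by rewrite /no_cancel inv_letterK (can2_eq inv_letterK inv_letterK) eq_sym (can2_eq inv_letterK inv_letterK) eq_sym. Qed.

Definition push (x : letter) (w : word) : word :=
  if w is y :: w' then if y == inv_letter x then w' else x :: w else [:: x].

Definition nf (w : word) : word := foldr push [::] w.
Definition winv (w : word) : word := rev (map inv_letter w).

Lemma push_reduced x w : reduced w -> reduced (push x w).
Proof.
case: w => //= y w; case: eqP => [_ /path_sorted //|/eqP ne] pw.
by rewrite /reduced /= /no_cancel ne.
Qed.

(** Van der Waerden's trick: letters act on reduced words by permutations, so the normal form
    depends only on the group element. *)
Lemma pushK x w : reduced w -> push (inv_letter x) (push x w) = w.
Proof.
case: w => [|y w] /=; first by rewrite inv_letterK eqxx.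
case: eqP => [->|_] /=; last by rewrite inv_letterK eqxx.
case: w => [|z w] //= /andP[]; rewrite /no_cancel inv_letterK => /negPf -> //.
Qed.

Lemma foldr_push_reduced z u : reduced z -> reduced (foldr push z u).
Proof. by move=> rz; elim: u => //= x u IH; exact: push_reduced. Qed.

Lemma nf_reduced w : reduced (nf w).
Proof. exact: foldr_push_reduced. Qed.

Lemma nf_id w : reduced w -> nf w = w.
Proof.
elim: w => //= x w IH rw; rewrite IH; last exact: path_sorted rw.
by case: w rw {IH} => //= y w /andP[/negPf ->].
Qed.

Lemma foldr_push z x u : reduced z ->
  foldr push z (push x u) = push x (foldr push z u).
Proof.
case: u => //= y u; case: eqP => // -> rz.
by rewrite -{1}(inv_letterK x) pushK //; apply: foldr_push_reduced.
Qed.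

Lemma nf_catl u v : nf (nf u ++ v) = nf (u ++ v).
Proof.
rewrite /nf !foldr_cat; elim: u => //= x u IH.
by rewrite foldr_push ?IH // nf_reduced.
Qed.

Lemma nf_catr u v : nf (u ++ nf v) = nf (u ++ v).
Proof. by rewrite /nf !foldr_cat -/(nf v) -/(nf (nf v)) nf_id // nf_reduced. Qed.

Lemma nf_cancel u x v : nf (u ++ x :: inv_letter x :: v) = nf (u ++ v).
Proof.
by rewrite /nf !foldr_cat /= -{1}(inv_letterK x) pushK // foldr_push_reduced.
Qed.

Lemma winvK : involutive winv.
Proof. by move=> w; rewrite /winv map_rev revK (mapK inv_letterK). Qed.

Lemma size_winv w : size (winv w) = size w.
Proof. by rewrite /winv size_rev size_map. Qed.

Lemma winv_reduced w : reduced (winv w) = reduced w.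
Proof.
rewrite /reduced /winv rev_sorted sorted_map.
by apply: eq_sorted => x y /=; rewrite -no_cancelC.
Qed.

Lemma nf_winvl u v : nf (winv u ++ u ++ v) = nf v.
Proof.
elim: u v => //= x u IH v.
rewrite /winv /= rev_cons cat_rcons -/(winv u) -{2}(inv_letterK x).
by rewrite nf_cancel IH.
Qed.

Lemma nf_winvr u v : nf (u ++ winv u ++ v) = nf v.
Proof. by rewrite -{1}(winvK u) nf_winvl. Qed.

Record fg := Fg { fgw :> seq letter; fgwP : reduced fgw }.
HB.instance Definition _ := [isSub for fgw].
HB.instance Definition _ := [Choice of fg by <:].

Definition of_word (w : word) : fg := Fg (nf_reduced w).
Definition fg_mul (x y : fg) : fg := of_word (x ++ y).
Definition fg_inv (x : fg) : fg := of_word (winv x).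
Definition fg_one : fg := of_word [::].

Lemma of_wordP u v : nf u = nf v -> of_word u = of_word v.
Proof. by move=> e; apply: val_inj. Qed.

Lemma fg_mulA : associative fg_mul.
Proof. by move=> x y z; apply: of_wordP; rewrite /= nf_catl nf_catr catA. Qed.
Lemma fg_mul1g : left_id fg_one fg_mul.
Proof. by move=> x; apply: val_inj; rewrite /= nf_id // fgwP. Qed.
Lemma fg_mulg1 : right_id fg_one fg_mul.
Proof. by move=> x; apply: val_inj; rewrite /= cats0 nf_id // fgwP. Qed.
Lemma fg_mulVg : left_inverse fg_one fg_inv fg_mul.
Proof. by move=> x; apply: of_wordP; rewrite /= nf_catl -{2}(cats0 x) nf_winvl. Qed.
Lemma fg_mulgV : right_inverse fg_one fg_inv fg_mul.
Proof. by move=> x; apply: of_wordP; rewrite /= nf_catr -(cats0 (winv x)) nf_winvr. Qed.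

HB.instance Definition _ := isGroup.Build fg fg_mulA fg_mul1g fg_mulg1 fg_mulVg fg_mulgV.

Local Open Scope group_scope.

Lemma fgw_mul (x y : fg) : fgw (x * y) = nf (x ++ y). Proof. by []. Qed.
Lemma fgw_inv (x : fg) : fgw x^-1 = winv x.
Proof. by rewrite /= nf_id // winv_reduced fgwP. Qed.

Lemma of_word_cat u v : of_word (u ++ v) = of_word u * of_word v.
Proof. by apply: of_wordP; rewrite /= nf_catl nf_catr. Qed.
Lemma of_word_fgw (x : fg) : of_word x = x.
Proof. by apply: val_inj; rewrite /= nf_id // fgwP. Qed.
Lemma of_word_winv w : of_word (winv w) = (of_word w)^-1.
Proof.
apply: (@mulgI _ (of_word w)); rewrite mulgV -of_word_cat.
by apply: of_wordP; rewrite -[winv w]cats0 nf_winvr.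
Qed.

Definition fgE := (@mulgA fg, @invgM fg, @invgK fg, @invg1 fg, @mulg1 fg, @mul1g fg,
  @mulgV fg, @mulVg fg, @mulgK fg, @mulgVK fg).

(** * Common prefixes and the tree metric *)

Fixpoint lcp (u v : word) : nat :=
  match u, v with
  | x :: u', y :: v' => if x == y then (lcp u' v').+1 else 0
  | _, _ => 0
  end.

(** The common prefix length is the Gromov product based at the identity; this inequality expresses
    that the Cayley graph is a tree. *)
Lemma lcp_ultra u v w : minn (lcp u v) (lcp v w) <= lcp u w.
Proof.
elim: u v w => [|x u IH] [|y v] [|z w] //=; rewrite ?min0n ?minn0 //.
case: (x =P y) => [<-|_]; last by rewrite min0n.
by case: (x =P z) => _; rewrite ?minn0 // minnSS ltnS.
Qed.

Lemma lcpC u v : lcp u v = lcp v u.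
Proof. by elim: u v => [|x u IH] [|y v] //=; rewrite eq_sym IH. Qed.

Lemma nf_winv_cat u v : reduced u -> reduced v ->
  nf (winv u ++ v) = winv (drop (lcp u v) u) ++ drop (lcp u v) v.
Proof.
elim: u v => [|x u IH] [|y v] ru rv.
- by [].
- exact: nf_id.
- by rewrite [lcp _ _]/= !drop0 !cats0; apply: nf_id; rewrite winv_reduced.
rewrite [lcp _ _]/=; case: (altP (x =P y)) => [<-|ne].
  rewrite /winv /= rev_cons cat_rcons -/(winv u) -[X in _ :: X :: _]inv_letterK.
  rewrite -(IH v (path_sorted ru) (path_sorted rv)).
  by rewrite -[in RHS](nf_cancel _ (inv_letter x)) .
apply: nf_id; rewrite ?drop0 /winv map_cons rev_cons cat_rcons /reduced sorted_cat_cons.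
apply/andP; split; first by move: ru; rewrite -winv_reduced /winv map_cons rev_cons.
by apply/andP; split=> //; rewrite /no_cancel inv_letterK eq_sym.
Qed.

Lemma lcp_size u v : lcp u v <= minn (size u) (size v).
Proof.
elim: u v => [|x u IH] [|y v] //=; case: eqP => // _; rewrite minnSS ltnS; exact: IH.
Qed.

Definition dist (x y : fg) : nat := size (fgw (x^-1 * y)).

Lemma fgw_mulVg (x y : fg) :
  fgw (x^-1 * y) = winv (drop (lcp x y) x) ++ drop (lcp x y) y.
Proof. by rewrite fgw_mul fgw_inv nf_winv_cat // fgwP. Qed.

Lemma distE (x y : fg) : dist x y + (lcp x y).*2 = size x + size y.
Proof.
rewrite /dist fgw_mulVg size_cat size_winv !size_drop.
have := lcp_size x y; lia.
Qed.

Lemma distC x y : dist x y = dist y x.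
Proof. have := distE x y; have := distE y x; rewrite lcpC; lia. Qed.

Lemma dist_transl g x y : dist (g * x) (g * y) = dist x y.
Proof. by rewrite /dist invgM -mulgA mulKg. Qed.

Lemma distxx x : dist x x = 0.
Proof. by rewrite /dist mulVg. Qed.

Lemma fgw_eq1 (x : fg) : (size x == 0) = (x == 1).
Proof. by rewrite size_eq0. Qed.

Lemma dist_eq0 x y : dist x y = 0 -> x = y.
Proof. by move/eqP; rewrite fgw_eq1 => /eqP /mulg1_eq; rewrite invgK. Qed.

(** The tree is bipartite, so adjacent vertices are never equidistant from a third one. *)
Lemma dist_parity x y z : ~~ odd (dist x y + dist y z + dist x z).
Proof.
have := distE x y; have := distE y z; have := distE x z; lia.
Qed.

(** Follows from [lcp_ultra] once distances are expressed by [distE]; the geometry of geodesics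
    below is drawn from this inequality. *)
Lemma four_point x y z t :
  dist x y + dist z t <= maxn (dist x z + dist y t) (dist x t + dist y z).
Proof.
have := distE x y; have := distE z t; have := distE x z; have := distE y t.
have := distE x t; have := distE y z.
have := lcp_ultra x z y; have := lcp_ultra x t y; have := lcp_ultra z x t.
have := lcp_ultra z y t.
rewrite (lcpC z x) (lcpC t y) (lcpC z y).
move: (lcp x y) (lcp z t) (lcp x z) (lcp y t) (lcp x t) (lcp y z) => u v a b c e.
case: (leqP a e); case: (leqP c b); case: (leqP a c); case: (leqP e b); lia.
Qed.

Lemma dist_triangle y x z : dist x z <= dist x y + dist y z.
Proof. have := distE x y; have := distE y z; have := distE x z; have := four_point x z y y.
rewrite distxx (distC z y); lia. Qed.

Lemma fgw_mul_cat (x y : fg) : size (fgw (x * y)) = size x + size y ->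
  fgw (x * y) = fgw x ++ fgw y.
Proof.
have := fgw_mulVg x^-1 y; rewrite invgK => -> .
rewrite size_cat size_winv !size_drop fgw_inv => e.
have -> : lcp (winv x) y = 0%N.
  have := lcp_size (winv x) y; move: e; rewrite size_winv; lia.
by rewrite !drop0 winvK.
Qed.

(** * Directions and betweenness in the tree *)

Definition letter_type (w : word) : bool := if w is l :: _ then l.1 == ga else false.
(** Only the type of the first letter is kept, not its sign, so three branches at a vertex never
    have pairwise distinct directions. For v = w the value is the default [false]. *)
Definition dir (v w : fg) : bool := letter_type (v^-1 * w).

Definition btw x y z := (dist x y + dist y z == dist x z)%N.

Lemma btwC x y z : btw x y z = btw z y x.
Proof. by rewrite /btw addnC (distC z y) (distC y x) (distC z x). Qed.

Lemma btw_transl g x y z : btw (g * x) (g * y) (g * z) = btw x y z.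
Proof. by rewrite /btw !dist_transl. Qed.

Lemma dir_transl g v w : dir (g * v) (g * w) = dir v w.
Proof. by rewrite /dir invgM -mulgA mulKg. Qed.

Lemma btw_cat v a w : btw v a w -> fgw (v^-1 * w) = fgw (v^-1 * a) ++ fgw (a^-1 * w).
Proof.
move/eqP => e; rewrite -fgw_mul_cat; first by rewrite mulgA mulgK.
by rewrite !mulgA mulgK.
Qed.

Lemma btw_dir v a w : btw v a w -> a <> v -> dir v a = dir v w.
Proof.
move=> b ne; rewrite /dir (btw_cat b).
case E: (fgw (v^-1 * a)) => [|l u] //; case: ne; apply/esym/dist_eq0.
by rewrite /dist E.
Qed.

(** Geodesic triangles are tripods: each side is covered by the other two. *)
Lemma btw_split y x t z : btw x t z -> btw x t y \/ btw y t z.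
Proof.
rewrite /btw => /eqP e; have := four_point x z t y.
have := dist_triangle t x y; have := dist_triangle t y z.
rewrite (distC z t) (distC z y) (distC t y).
by case: (leqP (dist x t + dist y z) (dist x y + dist t z)) => *; [left|right]; lia.
Qed.

Local Open Scope ring_scope.
Local Open Scope group_scope.

(** * Bi-infinite lines in the tree *)

Definition lg (l : letter) : fg := of_word [:: l].

Lemma lgV l : lg (inv_letter l) = (lg l)^-1.
Proof. by rewrite /lg -of_word_winv. Qed.

Lemma of_word_cons l w : of_word (l :: w) = lg l * of_word w.
Proof. by rewrite -of_word_cat. Qed.

Lemma of_word_rcons l w : of_word (rcons w l) = of_word w * lg l.
Proof. by rewrite -cats1 of_word_cat. Qed.

Lemma mkseq_cons T (f : nat -> T) m : mkseq f m.+1 = f 0%N :: mkseq (fun j => f j.+1) m.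
Proof. by rewrite /mkseq /= (iotaDl 1 0) -map_comp. Qed.

(** The vertex at position k of the line through the identity whose edge from k to k + 1 reads
    [w k]. *)
Definition phi (w : int -> letter) (k : int) : fg :=
  match k with
  | Posz m => of_word (mkseq (fun j => w j%:Z) m)
  | Negz m => (of_word (mkseq (fun j => w (j%:Z - m.+1%:Z)%R) m.+1))^-1
  end.

Lemma phi0 w : phi w 0 = 1. Proof. by []. Qed.

Lemma phiS w k : phi w (k + 1)%R = phi w k * lg (w k).
Proof.
case: k => [m|m].
  by rewrite -PoszD addn1 /= -of_word_rcons -mkseqS.
have -> : (Negz m + 1 = - m%:Z)%R by lia.
apply: (@mulIg _ (lg (w (Negz m)))^-1); rewrite mulgK.
case: m => [|m].
  by rewrite oppr0 phi0 mul1g.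
rewrite -NegzE /phi -invgM; congr _^-1.
rewrite [in RHS]mkseq_cons of_word_cons; congr (lg (w _) * of_word _).
Qed.

Lemma phi_cut w k (m : nat) :
  (phi w k)^-1 * phi w (k + m%:Z)%R = of_word (mkseq (fun t => w (k + t%:Z)%R) m).
Proof.
elim: m => [|m IH]; first by rewrite addr0 mulVg.
by rewrite mkseqS of_word_rcons -IH -addn1 PoszD addrA phiS mulgA.
Qed.

Lemma phi_cut_eq w w' k k' (m : nat) :
  (forall t : nat, (t < m)%N -> w (k + t%:Z)%R = w' (k' + t%:Z)%R) ->
  (phi w k)^-1 * phi w (k + m%:Z)%R = (phi w' k')^-1 * phi w' (k' + m%:Z)%R.
Proof.
move=> e; rewrite !phi_cut; congr of_word; apply/eq_in_map => t.
by rewrite mem_iota => /andP[_ /e].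
Qed.

Lemma phi_cut_rev w w' k k' (m : nat) :
  (forall t : nat, (t < m)%N -> w' (k' - 1 - t%:Z)%R = inv_letter (w (k + t%:Z)%R)) ->
  (phi w k)^-1 * phi w (k + m%:Z)%R = (phi w' k')^-1 * phi w' (k' - m%:Z)%R.
Proof.
elim: m => [|m IH] e; first by rewrite addr0 subr0 !mulVg.
rewrite -addn1 PoszD addrA phiS mulgA IH; last by move=> t tm; apply: e; lia.
rewrite -mulgA; congr (_ * _).
have -> : (k' - (m%:Z + 1) = k' - 1 - m%:Z)%R by lia.
have := phiS w' (k' - 1 - m%:Z)%R.
have -> : (k' - 1 - m%:Z + 1 = k' - m%:Z)%R by lia.
by rewrite e // lgV => ->; rewrite mulgVK.
Qed.

Lemma phi_eq w w' k : w =1 w' -> phi w k = phi w' k.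
Proof.
by move=> e; case: k => m /=; [|congr _^-1]; congr of_word; apply: eq_map => j; exact: e.
Qed.

Lemma phi_period w (T : int) : (forall k, w (k + T)%R = w k) ->
  forall k, phi w (k + T)%R = phi w T * phi w k.
Proof.
move=> per.
have step k : phi w (k + T)%R = phi w T * phi w k <->
              phi w (k + 1 + T)%R = phi w T * phi w (k + 1)%R.
  by rewrite addrAC !phiS per mulgA; split=> [->|/mulIg].
move=> k; elim/int_ind: k => [|k IH|k IH].
- by rewrite add0r phi0 mulg1.
- by rewrite -addn1 PoszD; apply/(step k%:Z).
- apply/step; have -> : (- (k.+1)%:Z + 1 = - k%:Z)%R by lia. exact: IH.
Qed.

(** * Gates and axes *)

Definition alternating (x : word) := sorted (fun l l' : letter => l.1 != l'.1) x.

Lemma alternating_reduced x : alternating x -> reduced x.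
Proof.
apply: sub_sorted => l l' ne; apply/eqP => e; by rewrite e eqxx in ne.
Qed.

Definition conv (C : fg -> Prop) := forall x y z, C x -> C z -> btw x y z -> C y.

(** Nearest-point projection onto a subtree, in the form used later: every geodesic from x into A
    passes through z. *)
Definition gate (A : fg -> Prop) (x z : fg) := A z /\ forall y, A y -> btw x z y.

Lemma gate_uniq A x z z' : gate A x z -> gate A x z' -> z = z'.
Proof.
move=> [az gz] [az' gz']; have /eqP := gz z' az'; have /eqP := gz' z az.
rewrite (distC z' z) => e1 e2; apply: dist_eq0; lia.
Qed.

Lemma gate_self (A : fg -> Prop) x : A x -> gate A x x.
Proof. by move=> ax; split=> // y _; rewrite /btw distxx. Qed.

Lemma gate_conv A C x z a : gate A x z -> conv C -> C x -> A a -> C a -> C z.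
Proof. by move=> [_ gz] cC cx aa ca; apply: cC (gz a aa). Qed.

Lemma btw_order x a b y : btw x a y -> btw x b y ->
  (btw x a b /\ btw a b y) \/ (btw x b a /\ btw b a y).
Proof.
rewrite /btw => /eqP ea /eqP eb; have := four_point x y a b.
have := dist_triangle a x b; have := dist_triangle b x a.
have := dist_triangle b a y; have := dist_triangle a b y.
rewrite (distC b a) (distC y b) (distC y a) (distC a y) (distC b y).
move: ea eb; rewrite (distC a y) (distC b y).
by case: (leqP (dist x a + dist y b) (dist x b + dist y a)) => *; [left|right]; lia.
Qed.

(** The geodesic from x to a1 runs through z and then z1. As z is not in A1, the gate g1 comes after
    z: up to z1 it lies in A2, beyond z1 in C, by convexity. *)
Lemma gate_cross (A1 A2 C : fg -> Prop) x a1 a2 z g1 :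
  conv A1 -> conv A2 -> conv C -> A1 a1 -> C a1 -> A2 a2 -> C a2 ->
  (exists z1, gate A2 a1 z1) ->
  gate A2 x z -> ~ C z -> ~ A1 z -> gate A1 x g1 -> C g1 \/ A2 g1.
Proof.
move=> cA1 cA2 cC A1a1 Ca1 A2a2 Ca2 [z1 Gz1] Gz nCz nAz [A1g1 Gg1].
have Cz1 : C z1 by apply: gate_conv Gz1 cC Ca1 A2a2 Ca2.
have A2z1 := Gz1.1; have A2z := Gz.1.
have zz1 : dist z z1 != 0 by apply/eqP => /dist_eq0 e; apply: nCz; rewrite e.
have [bz bz1] : btw x z a1 /\ btw z z1 a1.
  have := four_point x z1 a1 z; have := dist_triangle z x a1.
  have /eqP := Gz.2 z1 A2z1; have /eqP := Gz1.2 z A2z; have := dist_triangle z1 z a1.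
  rewrite /btw (distC z1 z) (distC a1 z1) (distC a1 z) (distC z1 a1); lia.
have b1 := Gg1 a1 A1a1.
have [[h1 h2]|[h1 h2]] := btw_order bz b1.
  have [[h3 h4]|[h3 h4]] := btw_order bz1 h2.
    by left; apply: cC h4.
  by right; apply: cA2 h3.
by case: nAz; apply: cA1 h2.
Qed.

(** Helly's property for three subtrees, with the common point made explicit as the gate of a1 on
    A2. *)
Lemma helly A1 A2 (C : fg -> Prop) a a1 a2 z1 : conv A1 -> conv C ->
  A1 a -> A2 a -> A1 a1 -> C a1 -> A2 a2 -> C a2 -> gate A2 a1 z1 ->
  [/\ C z1, A1 z1 & A2 z1].
Proof.
move=> cA1 cC A1a A2a A1a1 Ca1 A2a2 Ca2 Gz1; split; last exact: Gz1.1.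
  exact: gate_conv Gz1 cC Ca1 A2a2 Ca2.
exact: cA1 A1a1 A1a (Gz1.2 a A2a).
Qed.

Section Axis.
Variable w : int -> letter.
Hypothesis w_type : forall k, (w k).1 = if (2 %| k)%Z then ga else gb.

Definition axis (g : fg) (i : int) : fg := g * phi w i.
Definition on (g x : fg) : Prop := exists i, x = axis g i.

Lemma alternating_cut k (m : nat) : alternating (mkseq (fun t => w (k + t%:Z)%R) m).
Proof.
apply/(sortedP (ga, true)) => i; rewrite size_mkseq => lt.
by rewrite !nth_mkseq ?w_type //; [case: ifP; case: ifP => //; lia|lia].
Qed.

Lemma fgw_cut k (m : nat) :
  fgw ((phi w k)^-1 * phi w (k + m%:Z)%R) = mkseq (fun t => w (k + t%:Z)%R) m.
Proof. by rewrite phi_cut /= nf_id //; apply/alternating_reduced/alternating_cut. Qed.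

Lemma dist_axis g i j : dist (axis g i) (axis g j) = `|i - j|%N.
Proof.
rewrite /axis dist_transl.
wlog le : i j / (i <= j)%R => [hw|].
  by case/orP: (le_total i j) => /hw //; rewrite distC => ->; lia.
have -> : j = (i + `|j - i|%N%:Z)%R by lia.
by rewrite /dist fgw_cut size_mkseq; lia.
Qed.

Lemma axis_inj g i j : axis g i = axis g j -> i = j.
Proof. by move=> e; have := dist_axis g i j; rewrite e distxx; lia. Qed.

Lemma dir_right g i j : (i < j)%R -> dir (axis g i) (axis g j) = (2 %| i)%Z.
Proof.
move=> lt; rewrite /axis dir_transl /dir; have -> : j = (i + `|j - i|%N%:Z)%R by lia.
rewrite fgw_cut; case E: `|j - i|%N => [|m]; first by lia.
by rewrite mkseq_cons /= addr0 w_type; case: ifP.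
Qed.

Lemma dir_left g i j : (j < i)%R -> dir (axis g i) (axis g j) = ~~ (2 %| i)%Z.
Proof.
move=> lt; rewrite /axis dir_transl /dir.
have -> : (phi w i)^-1 * phi w j = ((phi w j)^-1 * phi w i)^-1 by rewrite !fgE.
rewrite fgw_inv; have -> : i = (j + `|i - j|%N%:Z)%R by lia.
rewrite fgw_cut; case E: `|i - j|%N => [|m]; first by lia.
rewrite mkseqS /winv -map_rev rev_rcons map_cons /= w_type.
have -> : forall b : bool, ((if b then ga else gb) == ga) = b by case.
lia.
Qed.

(** Letters alternate along an axis, so the two edges at each of its vertices have different
    types. *)
Lemma dir_opp g i j k : (j < i < k)%R ->
  dir (axis g i) (axis g j) != dir (axis g i) (axis g k).
Proof. by move=> /andP[h1 h2]; rewrite dir_left // dir_right //; case: (2 %| i)%Z. Qed.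

Lemma btw_axis g i j k : btw (axis g i) (axis g j) (axis g k) =
  ((i <= j <= k)%R || (k <= j <= i)%R).
Proof. by rewrite /btw !dist_axis; lia. Qed.

Lemma btw_uniq x a b y : btw x a y -> btw x b y -> dist x a = dist x b -> a = b.
Proof.
move=> ba bb e; apply: dist_eq0.
by have := distC a b; case: (btw_order ba bb) => -[/eqP h _]; lia.
Qed.

Lemma on_btw g i k y : (i <= k)%R -> btw (axis g i) y (axis g k) ->
  exists j, y = axis g j /\ (i <= j <= k)%R.
Proof.
move=> le b; exists (i + (dist (axis g i) y)%:Z)%R.
have le2 : (dist (axis g i) y)%:Z <= k - i.
  by have /eqP := b; rewrite dist_axis; lia.
split; last by lia.
apply: btw_uniq b _ _; first by rewrite btw_axis; lia.
by rewrite dist_axis; lia.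
Qed.

Lemma conv_on g : conv (on g).
Proof.
move=> x y z [i ->] [k ->] b; case/orP: (le_total i k) => le.
  by have [j [-> _]] := on_btw le b; exists j.
by rewrite btwC in b; have [j [-> _]] := on_btw le b; exists j.
Qed.

Lemma on_axis g i : on g (axis g i). Proof. by exists i. Qed.

Lemma gate_axis g x : exists i, gate (on g) x (axis g i).
Proof.
have [m] := ubnP (dist x (axis g 0)).
elim: m (0 : int) => // m IH i lt.
have tri j k := dist_triangle (axis g j) x (axis g k).
case: (ltnP (dist x (axis g (i + 1)%R)) (dist x (axis g i))) => [lt1|le1].
  by apply: (IH (i + 1)%R); lia.
case: (ltnP (dist x (axis g (i - 1)%R)) (dist x (axis g i))) => [lt2|le2].
  by apply: (IH (i - 1)%R); lia.
exists i; split=> [|_ [j ->]]; first exact: on_axis.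
(* At a vertex of locally least distance the next vertex is strictly farther, by parity, and the
   four-point inequality extends this to the whole side. *)
have step (e : int) : (e = 1 \/ e = -1)%R -> (dist x (axis g i) <= dist x (axis g (i + e)%R))%N ->
  (0 < (j - i) * e)%R -> btw x (axis g i) (axis g j).
  have := dist_parity x (axis g i) (axis g (i + e)%R).
  have := four_point x (axis g (i + e)%R) (axis g i) (axis g j).
  have := tri i j; have := tri i (i + e)%R.
  by rewrite /btw !dist_axis => *; lia.
have [lt3|[lt3|->]] : (i < j \/ j < i \/ j = i)%R by lia.
- by apply: (step 1%R) => //; lia.
- by apply: (step (-1)%R) => //; lia.
- by rewrite /btw distxx addn0.
Qed.
End Axis.

(** * Windmills *)

Section Period.
Variables (w : int -> letter) (T : int).
Hypothesis w_per : forall k : int, w (k + T)%R = w k.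

Lemma w_perM m k : w (k + T * m)%R = w k.
Proof.
elim/int_ind: m k => [|m IH|m IH] k; first by rewrite mulr0 addr0.
  have -> : (k + T * m.+1%:Z = (k + T * m%:Z) + T)%R by lia.
  by rewrite w_per.
rewrite -w_per; have -> : (k + T * - m.+1%:Z + T = k + T * - m%:Z)%R by lia.
exact: IH.
Qed.

Lemma phi_perM m k : phi w (k + T * m)%R = phi w (T * m)%R * phi w k.
Proof. by apply: phi_period => j; exact: w_perM. Qed.

End Period.

Section Windmill.
Variables (w : int -> letter) (T n : int) (piece : int -> int -> Prop).
Hypothesis w_type : forall k : int, (w k).1 = if (2 %| k)%Z then ga else gb.
Hypothesis w_per : forall k : int, w (k + T)%R = w k.
Notation M := (T * n)%R.
Definition same (g h : fg) : Prop := exists m : int, g = h * phi w (T * m)%R.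
Hypothesis M_gt0 : (0 < M)%R.
Hypothesis piece_len : forall i i' : int, (i < i')%R -> piece i i' -> ((i' - i) * 3 < M)%R.
Hypothesis piece_sub : forall i i' j j' : int, piece i i' -> (i <= j)%R -> (j' <= i')%R -> piece j j'.
Hypothesis piece_shift : forall i i' m : int, piece i i' -> piece (i + T * m)%R (i' + T * m)%R.
Hypothesis overlap : forall g h (i i' j j' : int), (i < i')%R ->
  axis w g i = axis w h j -> axis w g i' = axis w h j' -> piece i i' \/ same g h.

Notation L := (axis w).
Notation on := (on w).

Lemma phi_perD a b : phi w (T * (a + b))%R = phi w (T * a)%R * phi w (T * b)%R.
Proof. by rewrite mulrDr (addrC (T * a)%R) (phi_perM w_per). Qed.

(** The translation by n j periods along the axis of g; for the line of slope r with T = 2 p,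
    [axrot g 1] is the conjugate by g of the relator. *)
Definition axrot (g : fg) (j : int) : fg := g * phi w (M * j)%R * g^-1.

Lemma rot_axis g j i : axrot g j * L g i = L g (i + M * j)%R.
Proof. by rewrite /axrot /axis -(mulrA T n j) (phi_perM w_per) !fgE. Qed.

Lemma rotD g i j : axrot g (i + j)%R = axrot g i * axrot g j.
Proof. by rewrite /axrot -!(mulrA T n) mulrDr phi_perD !fgE. Qed.

Lemma rot0 g : axrot g 0 = 1.
Proof. by rewrite /axrot mulr0 phi0 !fgE. Qed.

Lemma rotV g j : (axrot g j)^-1 = axrot g (- j)%R.
Proof. by apply: mulg1_eq; rewrite -rotD subrr rot0. Qed.

Lemma rotJ x g j : x * axrot g j * x^-1 = axrot (x * g) j.
Proof. by rewrite /axrot !fgE. Qed.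

Lemma rot_same g h j : same g h -> axrot g j = axrot h j.
Proof.
move=> [m ->]; rewrite /axrot -(mulrA T n).
have c : phi w (T * m)%R * phi w (T * (n * j))%R = phi w (T * (n * j))%R * phi w (T * m)%R.
  by rewrite -!phi_perD addrC.
by rewrite invgM !mulgA -(mulgA h) c !mulgA mulgK.
Qed.

Lemma same_sym g h : same g h -> same h g.
Proof.
move=> [m ->]; exists (- m)%R; rewrite -mulgA -phi_perD subrr mulr0 phi0.
by rewrite mulg1.
Qed.

Lemma same_transl x g h : same g h -> same (x * g) (x * h).
Proof. by move=> [m ->]; exists m; rewrite mulgA. Qed.

Lemma same_translK x g h : same (x * g) (x * h) -> same g h.
Proof. by move/(same_transl x^-1); rewrite !mulKg. Qed.

Lemma axis_transl x g i : x * L g i = L (x * g) i.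
Proof. by rewrite /axis mulgA. Qed.

Lemma on_transl x g y : on g y -> on (x * g) (x * y).
Proof. by move=> [i ->]; exists i; rewrite axis_transl. Qed.

Lemma on_same g h y : same g h -> on g y -> on h y.
Proof.
move=> [m ->] [i ->]; exists (i + T * m)%R.
by rewrite /axis (phi_perM w_per) mulgA.
Qed.

Lemma on_rot g j y : on g y -> on g (axrot g j * y).
Proof. by move=> [i ->]; rewrite rot_axis; exists (i + M * j)%R. Qed.

Lemma gate_rot g x i j : gate (on g) x (L g i) ->
  gate (on g) (axrot g j * x) (L g (i + M * j)%R).
Proof.
move=> [_ gz]; split; first exact: on_axis.
move=> y oy; rewrite -rot_axis -(mulVKg (axrot g j) y) btw_transl rotV.
by apply: gz; apply: on_rot.
Qed.

(* The segment from [i] to [i'] covers [n] periods less at most one piece. *)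
Definition big (i i' : int) := ((i + M <= i')%R \/ piece (i' - M)%R i).

Definition has_window (x : fg) : Prop := exists g (i i' : int),
  ((i < i')%R /\ big i i' \/ (i' < i)%R /\ big i' i) /\
  (dist 1%g (L g i) + `|i' - i|%N + dist (L g i') x = dist 1%g x)%N.

Definition full (N W : fg -> Prop) g := N (axrot g 1) /\ forall i, W (L g i).

(** The invariant of the induction: by [wmP] each axis is absorbed or meets W in at most a piece,
    and [wmS] is the spelling property for N. *)
Record windmill (N W : fg -> Prop) : Prop := Windmill {
  wm1 : N 1;
  wmM : forall x y, N x -> N y -> N (x * y);
  wmV : forall x, N x -> N x^-1;
  wmC : conv W;
  wmN : forall x y, N x -> W y -> W (x * y);
  wmW1 : W 1;
  wmP : forall g, full N W g \/
    forall i i' : int, (i < i')%R -> W (L g i) -> W (L g i') -> piece i i';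
  wmS : forall x, N x -> x <> 1 -> alternating x -> has_window x }.

Section Step.
Variables (N W : fg -> Prop).
Hypothesis wm : windmill N W.

(** * Fresh axes and the positions where they are met *)

Definition fresh g := (exists i, W (L g i)) /\ ~ full N W g.

(** The positions where the rest of the construction can attach to the axis of g. *)
Definition near g i := W (L g i) \/ exists h, [/\ fresh h, ~ same h g & on h (L g i)].

Lemma fresh_piece g i i' : fresh g -> (i < i')%R -> W (L g i) -> W (L g i') -> piece i i'.
Proof. by move=> [_ nN] lt Wi Wi'; have [//|P] := wmP wm g; exact: P. Qed.

Lemma fresh_close g i i' : fresh g -> W (L g i) -> W (L g i') -> (`|i - i'|%:Z * 3 < M)%R.
Proof.
move=> fg Wi Wi'; have [lt|[lt|e]] : (i < i' \/ i' < i \/ i = i')%R by lia.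
- by have := piece_len lt (fresh_piece fg lt Wi Wi'); lia.
- by have := piece_len lt (fresh_piece fg lt Wi' Wi); lia.
- by move: M_gt0; lia.
Qed.

Lemma overlap_close g h i i' : ~ same h g -> on h (L g i) -> on h (L g i') ->
  (`|i - i'|%:Z * 3 < M)%R.
Proof.
move=> ns [j e] [j' e']; have [lt|[lt|ee]] : (i < i' \/ i' < i \/ i = i')%R by lia.
- case: (overlap lt e e') => [P|/same_sym //]; have := piece_len lt P; lia.
- case: (overlap lt e' e) => [P|/same_sym //]; have := piece_len lt P; lia.
- by move: M_gt0; lia.
Qed.

(** The two axes and W meet pairwise, so Helly's property applies. *)
Lemma fresh_helly g h x : fresh g -> fresh h -> on g x -> on h x ->
  exists c, W (L g c) /\ on h (L g c).
Proof.
move=> [[i Wi] _] [[j Wj] _] og oh.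
have [c Gc] := gate_axis w_type g (L h j); exists c.
have [Wc hc _] := helly (conv_on w_type (g := h)) (wmC wm) oh og (on_axis w h j) Wj (on_axis w g i) Wi Gc.
by [].
Qed.

Lemma near_close g i : fresh g -> near g i ->
  exists c, W (L g c) /\ (`|i - c|%:Z * 3 < M)%R.
Proof.
move=> fg [Wi|[h [fh ns oh]]]; first by exists i; split=> //; move: M_gt0; lia.
have [c [Wc hc]] := fresh_helly fg fh (on_axis w g i) oh.
by exists c; split=> //; exact: overlap_close ns oh hc.
Qed.

(** Three gaps, from i to W, inside W, and from W to i', are each less than a third of M; this
    explains the factor 3 in [piece_len]. *)
Lemma near_apart g i i' j : fresh g -> near g i -> near g i' -> j <> 0 -> i <> (i' + M * j)%R.
Proof.
move=> fg ni ni' j0 e.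
have [c [Wc lc]] := near_close fg ni; have [c' [Wc' lc']] := near_close fg ni'.
have := fresh_close fg Wc Wc'.
have : (M <= `|i - i'|%:Z)%R.
  have -> : (i - i' = M * j)%R by lia.
  rewrite abszM PoszM; move: M_gt0; move: j0; clear; nia.
lia.
Qed.

(** * Chains of rotations about fresh axes *)

Section Chains.
Variables (S0 : fg -> Prop) (b : bool).

(* Points of [S0] carried along a sequence of fresh axes, consecutive ones being
   distinct; with [b] also the points of the last axis itself. *)
Inductive chain : fg -> fg -> Prop :=
  | chain_on g x of b & fresh g & on g x : chain g x
  | chain_start g j x of fresh g & j <> 0 & S0 x : chain g (axrot g j * x)
  | chain_step g h j x of fresh g & j <> 0 & chain h x & ~ same h g :
      chain g (axrot g j * x).

(** One closure is used twice: on N without the axes for the new subgroup, on W with them for the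
    new convex set. *)
Definition reach x := S0 x \/ exists g, chain g x.

Lemma chain_fresh g x : chain g x -> fresh g.
Proof. by case. Qed.

(** A rotation about the last axis of the chain merges with the last rotation, possibly cancelling
    it; a rotation about another axis lengthens the chain. *)
Lemma reach_rot h j x : fresh h -> reach x -> reach (axrot h j * x).
Proof.
move=> fh; have [->|/eqP j0] := eqVneq j 0; first by rewrite rot0 mul1g.
case=> [Sx|[g cx]]; first by right; exists h; apply: chain_start.
have [/same_sym s|ns] := classic (same g h); last first.
  by right; exists h; apply: chain_step cx ns.
rewrite (rot_same _ s); case: cx {s} => {}g.
- move=> {}x bT fg og; right; exists g; apply: chain_on => //; exact: on_rot.
- move=> i {}x fg i0 Sx; rewrite mulgA -rotD.
  have [->|/eqP k0] := eqVneq (j + i)%R 0; first by rewrite rot0 mul1g; left.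
  by right; exists g; apply: chain_start.
- move=> k i {}x fg i0 ck ns; rewrite mulgA -rotD.
  have [->|/eqP k0] := eqVneq (j + i)%R 0; first by rewrite rot0 mul1g; right; exists k.
  by right; exists g; apply: chain_step ck ns.
Qed.

Hypothesis SN : forall x y, N x -> S0 y -> S0 (x * y).

Lemma fresh_transl y g : N y -> fresh g -> fresh (y * g).
Proof.
move=> Ny [[i Wi] nN]; split.
  by exists i; rewrite -axis_transl; apply: wmN Ny Wi.
case=> Nr Wr; apply: nN; have NV := wmV wm Ny; split=> [|k].
  rewrite -(mulKg y g) -rotJ.
  by apply: (wmM wm); [exact: (wmM wm)|exact: (wmV wm)].
by rewrite -(mulKg y (L g k)) axis_transl; apply: wmN NV _.
Qed.

Lemma chain_N y g x : N y -> chain g x -> chain (y * g) (y * x).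
Proof.
have e g0 j z : y * (axrot g0 j * z) = axrot (y * g0) j * (y * z) by rewrite -rotJ !fgE.
move=> Ny; elim=> {g x} [g x bT fg og|g j x fg j0 Sx|g h j x fg j0 cx IH ns].
- by apply: chain_on => //; [exact: fresh_transl|exact: on_transl].
- by rewrite e; apply: chain_start => //; [exact: fresh_transl|exact: SN].
- rewrite e; apply: chain_step IH _ => //; first exact: fresh_transl.
  by move/same_translK.
Qed.

Lemma reach_N y x : N y -> reach x -> reach (y * x).
Proof.
move=> Ny [Sx|[g cx]]; first by left; apply: SN.
by right; exists (y * g); apply: chain_N.
Qed.

Hypothesis SW : forall x, S0 x -> W x.

Lemma cross g h x z y : fresh g -> fresh h -> gate (on g) x z -> ~ W z -> ~ on h z ->
  gate (on h) x y -> W y \/ on g y.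
Proof.
move=> [[i1 Wi1] _] [[i2 Wi2] _] Gz nW no Gy.
apply: (gate_cross (conv_on w_type (g := h)) (conv_on w_type (g := g)) (wmC wm)
  (on_axis w h i2) Wi2 (on_axis w g i1) Wi1 _ Gz nW no Gy).
by have [k Gk] := gate_axis w_type g (L h i2); exists (L g k).
Qed.

Definition far g x := exists i j,
  [/\ j <> 0, near g i & gate (on g) x (L g (i + M * j)%R)].

Lemma far_not_near g x : fresh g -> far g x ->
  exists i, gate (on g) x (L g i) /\ ~ near g i.
Proof.
move=> fg [i [j [j0 ni Gx]]]; exists (i + M * j)%R; split=> // nj.
exact: near_apart fg nj ni j0 erefl.
Qed.

(** A far point leaves g at a position that is not near, hence neither in W nor on h, and [cross]
    applies. A point of g is its own gate there, and the cases where it lies in W or on h are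
    direct. *)
Lemma far_cross g h x y : fresh g -> fresh h -> ~ same h g -> on g x \/ far g x ->
  gate (on h) x y -> W y \/ on g y.
Proof.
move=> fg fh ns [og|/(far_not_near fg)[i [Gx nn]]] Gy; last first.
  by apply: (cross fg fh Gx) Gy => [Wi|oi]; apply: nn; [left|right; exists h].
have [Wx|nW] := classic (W x).
  by left; have [[i Wi] _] := fh; apply: gate_conv Gy (wmC wm) Wx (on_axis w h i) Wi.
have [ox|nox] := classic (on h x).
  by right; rewrite (gate_uniq Gy (gate_self ox)).
exact: cross fg fh (gate_self og) nW nox Gy.
Qed.

(** Ping-pong: the previous point of the chain projects to a near position of g, and the nontrivial
    rotation moves this projection by a nonzero multiple of M. *)
Lemma chain_far g x : chain g x -> (b /\ on g x) \/ far g x.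
Proof.
elim=> {g x} [g x bT fg og|g j x fg j0 Sx|g h j x fg j0 cx IH ns]; first by left.
- right; have [[i0 Wi0] _] := fg; have [i Gi] := gate_axis w_type g x.
  exists i, j; split=> //; last exact: gate_rot.
  by left; apply: gate_conv Gi (wmC wm) (SW Sx) (on_axis w g i0) Wi0.
- right; have [i Gi] := gate_axis w_type g x.
  have fh := chain_fresh cx.
  exists i, j; split=> //; last exact: gate_rot.
  have ns' : ~ same g h by move/same_sym.
  have [|Wi|oi] := far_cross fh fg ns' _ Gi; first by case: IH => [[]|]; [left|right].
    by left.
  by right; exists h.
Qed.

Lemma chain_cross g h x y : chain g x -> fresh h -> ~ same h g ->
  gate (on h) x y -> W y \/ on g y.
Proof.
move=> cx fh ns; apply: far_cross (chain_fresh cx) fh ns _.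
by case: (chain_far cx) => [[]|]; [left|right].
Qed.
End Chains.

(** * The enlarged group and the enlarged convex set *)

Definition N' := reach N false.
Definition W' := reach W true.

Lemma reach_N' (S0 : fg -> Prop) b x y : (forall x y, N x -> S0 y -> S0 (x * y)) ->
  N' x -> reach S0 b y -> reach S0 b (x * y).
Proof.
move=> SN [Nx|[g cx]] ry; first exact: reach_N.
elim: cx => {g x} // [g j x fg _ Nx|g h j x fg _ cx IH _]; rewrite -mulgA;
  apply: reach_rot => //; exact: reach_N.
Qed.

Lemma N'_mul x y : N' x -> N' y -> N' (x * y).
Proof. by apply: reach_N' => *; apply: (wmM wm). Qed.

Lemma N'_W' x y : N' x -> W' y -> W' (x * y).
Proof. by apply: reach_N' => *; apply: (wmN wm). Qed.

Lemma N'_rot g j : fresh g -> N' (axrot g j).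
Proof. by move=> fg; rewrite -[axrot g j]mulg1; apply: reach_rot => //; left; exact: wm1 wm. Qed.

Lemma N'_inv x : N' x -> N' x^-1.
Proof.
case=> [Nx|[g cx]]; first by left; apply: (wmV wm).
elim: cx => {g x} // [g j x fg _ Nx|g h j x fg _ cx IH _]; rewrite invgM rotV;
  apply: N'_mul (N'_rot _ fg) => //; left; exact: (wmV wm).
Qed.

Lemma W'_on g x : fresh g -> on g x -> W' x.
Proof. by move=> fg og; right; exists g; apply: chain_on. Qed.

Definition joined x y := forall z, btw x z y -> W' z.

Lemma joined_trans y x z : joined x y -> joined y z -> joined x z.
Proof. by move=> h1 h2 t /(btw_split y) [/h1|/h2]. Qed.

Lemma joined_sym x y : joined x y -> joined y x.
Proof. by move=> h z; rewrite btwC => /h. Qed.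

Lemma joined_transl g x y : N' g -> joined x y -> joined (g * x) (g * y).
Proof.
move=> Ng h z; rewrite -(mulVKg g z) btw_transl => /h; exact: N'_W'.
Qed.

Lemma joined_W x y : W x -> W y -> joined x y.
Proof. by move=> Wx Wy z bz; left; apply: (wmC wm) bz. Qed.

Lemma joined_on g x y : fresh g -> on g x -> on g y -> joined x y.
Proof. by move=> fg ox oy z bz; apply: W'_on fg _; apply: (conv_on w_type) bz. Qed.

Lemma joined_rot g j x : fresh g -> W x -> joined 1 (axrot g j * x).
Proof.
move=> fg Wx; have [[i Wi] _] := fg.
apply: (@joined_trans (L g i)); first exact: joined_W (wmW1 wm) Wi.
apply: (@joined_trans (axrot g j * L g i)).
  apply: joined_on fg _ _; first exact: on_axis.
  by apply: on_rot; exact: on_axis.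
by apply: joined_transl; [exact: N'_rot|exact: joined_W].
Qed.

Lemma W'_joined x : W' x -> joined 1 x.
Proof.
case=> [Wx|[g cx]]; first exact: joined_W (wmW1 wm) Wx.
elim: cx => {g x} [g x _ fg og|g j x fg _ Wx|g h j x fg _ cx IH _].
- have [[i Wi] _] := fg; apply: (@joined_trans (L g i)); first exact: joined_W (wmW1 wm) Wi.
  exact: joined_on fg (on_axis w g i) og.
- exact: joined_rot.
- apply: (@joined_trans (axrot g j * 1)); first exact: joined_rot (wmW1 wm).
  by apply: joined_transl IH; exact: N'_rot.
Qed.

(** Each point of W' is joined to the identity, and joined pairs compose because triangles are
    tripods. *)
Lemma W'_conv : conv W'.
Proof.
move=> x y z Wx Wz; apply: (@joined_trans 1); last exact: W'_joined.
exact/joined_sym/W'_joined.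
Qed.

Lemma two_gates A x y z z' : gate A x z -> gate A y z' -> z <> z' ->
  (dist x z + dist z z' + dist z' y = dist x y)%N.
Proof.
move=> [az gz] [az' gz'] ne; have := four_point x z' y z.
have := dist_triangle z x y; have := dist_triangle z' z y.
have /eqP := gz z' az'; have /eqP := gz' z az.
have zz : dist z z' != 0%N by apply/eqP => /dist_eq0.
rewrite (distC y z') (distC z' z) (distC z' y) (distC y z); lia.
Qed.

(** The edges before and after v carry consecutive letters of x, which differ in type. Alternation
    reaches [no_early_exit] in this form. *)
Lemma alternating_dir (v x : fg) : alternating x -> btw 1 v x -> v <> 1 -> v <> x ->
  dir v 1 != dir v x.
Proof.
move=> ax bv v1 vx; have := btw_cat bv; rewrite invg1 !mul1g => e.
rewrite /dir mulg1 fgw_inv; move: ax; rewrite e.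
case/lastP E: (fgw v) => [|u l].
  by case: v1; apply/eqP; rewrite -fgw_eq1 E.
case F: (fgw (v^-1 * x)) => [|l' u'].
  by case: vx; apply: dist_eq0; rewrite /dist F.
rewrite /winv map_rcons rev_rcons /= /alternating cat_rcons sorted_cat_cons /=.
by case/and3P => _ + _; case: (l.1); case: (l'.1).
Qed.

Lemma not_same_sym g h : ~ same g h -> ~ same h g.
Proof. by move=> ns /same_sym. Qed.

(* The path leaves the axis of [g] at [L g i0]; by alternation it cannot do so
   before having reached a point where the axis meets [W]. *)
Lemma no_early_exit g h y p i0 i1 c :
  fresh g -> fresh h -> ~ same h g -> far h y ->
  gate (on g) y (L g i0) -> on h (L g i0) -> W (L g c) -> on h (L g c) ->
  gate (on g) p (L g i1) ->
  (btw p (L g i0) y -> L g i0 <> p -> L g i0 <> y -> dir (L g i0) p != dir (L g i0) y) ->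
  i0 <> i1 -> ~ ((i1 < i0 < c)%R \/ (c < i0 < i1)%R).
Proof.
move=> fg fh ns /(far_not_near fh)[m [Gm nm]] Gy [a0 ea0] Wc [c' ec'] Gp alt ne bad.
have nz : ~ on g (L h m).
  by move=> oz; apply: nm; right; exists g; split=> //; exact: not_same_sym.
have d1 : dir (L g i0) (L g i1) != dir (L g i0) (L g c).
  by case: bad => [/(dir_opp w_type g)//|]; rewrite eq_sym => /(dir_opp w_type g).
have ma : m <> a0 by move=> e; apply: nz; rewrite e -ea0; exact: on_axis.
have mc : m <> c' by move=> e; apply: nz; rewrite e -ec'; exact: on_axis.
have ca : c' <> a0.
  by move=> e; have : c = i0; [apply: (axis_inj w_type (g := g)); rewrite ec' ea0 e|lia].
have d2 : dir (L g i0) (L h m) != dir (L g i0) (L g c).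
  (* If m is between a0 and c', it lies on g; if c' is between a0 and m, then i0 is not the gate of
     y; if a0 is in the middle, the directions are opposite. *)
  have [b1|[b1|[b1|b1]]] : ((a0 < m < c') \/ (c' < m < a0))%R \/
     (((a0 < c' < m) \/ (m < c' < a0))%R \/ ((m < a0 < c')%R \/ (c' < a0 < m)%R)) by lia.
  - case: nz; apply: (conv_on w_type (on_axis w g i0) (on_axis w g c)).
    by rewrite ea0 ec' btw_axis //; lia.
  - have /eqP := Gy.2 _ (on_axis w g c).
    have /eqP := Gm.2 _ (on_axis w h a0); have /eqP := Gm.2 _ (on_axis w h c').
    by rewrite -ec' -ea0 ec' ea0 !dist_axis //; lia.
  - by rewrite ea0 ec'; exact: dir_opp.
  - by rewrite ea0 ec' eq_sym; exact: dir_opp.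
have e1 : dir (L g i0) (L g i1) = dir (L g i0) p.
  apply: btw_dir; last by move/(axis_inj w_type) => e; apply: ne.
  by rewrite btwC; apply: Gp.2; exact: on_axis.
have e2 : dir (L g i0) (L h m) = dir (L g i0) y.
  apply: btw_dir; last by rewrite ea0 => /(axis_inj w_type).
  by rewrite btwC ea0; apply: Gm.2; exact: on_axis.
have : dir (L g i0) p != dir (L g i0) y.
  apply: alt.
  - apply/eqP; have := two_gates Gp Gy.
    have /eqP := Gp.2 _ (on_axis w g i0).
    have nn : L g i1 <> L g i0 by move/(axis_inj w_type) => e; apply: ne.
    by move=> e /(_ nn); lia.
  - move=> e; have og : on g p by rewrite -e; exact: on_axis.
    by apply: ne; apply: (axis_inj w_type (g := g)); rewrite (gate_uniq Gp (gate_self og)).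
  - move=> e; have oh : on h y by rewrite -e ea0; exact: on_axis.
    by apply: ma; apply: (axis_inj w_type (g := h)); rewrite (gate_uniq Gm (gate_self oh)) -e.
(* There are only two directions, and both ends of the path avoid that of c, so they agree, against
   [alt]. *)
by rewrite -e1 -e2; move: d1 d2; do 3![case: (dir _ _)].
Qed.

Lemma N_W x : N x -> W x.
Proof. by move=> Nx; rewrite -(mulg1 x); apply: (wmN wm Nx (wmW1 wm)). Qed.

(** When the segment falls short of n periods, the missing part lies, up to a shift by M, between c
    and i. Both are positions in W, so it is a piece. *)
Lemma window_big g i i0 c j : fresh g -> W (L g i) -> near g i0 -> W (L g c) ->
  (`|i0 - c|%:Z * 3 < M)%R -> j <> 0 ->
  ~ ((i - M * j < i0 < c)%R \/ (c < i0 < i - M * j)%R) ->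
  let i' := (i0 + M * j)%R in
  (i < i')%R /\ big i i' \/ (i' < i)%R /\ big i' i.
Proof.
move=> fg Wi ni Wc lc j0 nb i'; have := fresh_close fg Wi Wc => lic.
have [jp|jn] : (0 < j \/ j < 0)%R by lia.
- have Mj : (M <= M * j)%R by move: M_gt0 jp; clear; nia.
  left; split; first by rewrite /i'; lia.
  (* Since i and i0 are less than M apart, i - M j < i0, and [nb] leaves only c <= i0. *)
  have le : (c + M * j <= i')%R by rewrite /i'; lia.
  have [h|h] : (i + M <= i' \/ i' < i + M)%R by lia.
    by left.
  right; apply: (piece_sub (i := c) (i' := i)); [|lia|lia].
  by apply: fresh_piece fg _ Wc Wi; lia.
- have Mj : (M * j <= - M)%R by move: M_gt0 jn; clear; nia.
  right; split; first by rewrite /i'; lia.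
  have le : (i' <= c + M * j)%R by rewrite /i'; lia.
  have [h|h] : (i' + M <= i \/ i < i' + M)%R by lia.
    by left.
  right; apply: (piece_sub (i := (i - M)%R) (i' := (c - M)%R)); [|lia|lia].
  have -> : (i - M = i + T * - n)%R by lia.
  have -> : (c - M = c + T * - n)%R by lia.
  by apply: piece_shift; apply: fresh_piece fg _ Wi Wc; lia.
Qed.

Lemma window_path g x i i' : gate (on g) 1 (L g i) -> gate (on g) x (L g i') -> i <> i' ->
  (dist 1%g (L g i) + `|i' - i|%N + dist (L g i') x = dist 1%g x)%N.
Proof.
move=> G1 Gx ne; have nn : L g i <> L g i' by move/(axis_inj w_type).
by rewrite -(two_gates G1 Gx nn) dist_axis //; lia.
Qed.

(** The window lies on the last axis g of the chain, between the gate of 1 and the gate of the word,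
    which is the rotated gate of the previous point. *)
Lemma N'_window x : N' x -> x <> 1 -> alternating x -> has_window x.
Proof.
case=> [Nx|[g cx]] x1 ax; first exact: (wmS wm).
have fg := chain_fresh cx; have [[k Wk] _] := fg.
have [i Gi] := gate_axis w_type g 1.
have Wi : W (L g i) := gate_conv Gi (wmC wm) (wmW1 wm) (on_axis w g k) Wk.
have fin i0 c j : near g i0 -> gate (on g) x (L g (i0 + M * j)%R) -> j <> 0 ->
    W (L g c) -> (`|i0 - c|%:Z * 3 < M)%R ->
    ~ ((i - M * j < i0 < c)%R \/ (c < i0 < i - M * j)%R) -> has_window x.
  move=> ni Gx j0 Wc lc nb; exists g, i, (i0 + M * j)%R; split.
    exact: window_big Wc lc j0 nb.
  apply: window_path => // e; apply: (near_apart fg _ ni j0 e).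
  by left.
case: cx fg Gi k Wk Wi fin ax x1 => {g x} // [g j x _ j0 Nx|g h j x _ j0 cx ns] fg Gi k Wk Wi fin ax x1.
- have [i0 G0] := gate_axis w_type g x.
  have W0 : W (L g i0) := gate_conv G0 (wmC wm) (N_W Nx) (on_axis w g k) Wk.
  apply: (fin i0 i0 j) => //; [by left|exact: gate_rot|by move: M_gt0; lia|by lia].
- have [i0 G0] := gate_axis w_type g x.
  have fh := chain_fresh cx; have Gx := gate_rot j G0.
  have fa : far h x by case: (chain_far N_W cx) => [[]|].
  have [|W0|o0] := far_cross fh fg (not_same_sym ns) _ G0; first by right.
    by apply: (fin i0 i0 j) => //; [left|move: M_gt0; lia|lia].
  have [c [Wc hc]] := fresh_helly fg fh (on_axis w g i0) o0.
  have n0 : near g i0 by right; exists h.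
  apply: (fin i0 c j) => //; first exact: overlap_close ns o0 hc.
  (* The path from 1 to the word is rotated back: alternation at i0 is then read on the path from
     the image of 1 to the previous point. *)
  have Gp : gate (on g) (axrot g (- j)%R * 1) (L g (i - M * j)%R).
    by have := gate_rot (- j)%R Gi; rewrite mulrN.
  apply: (no_early_exit fg fh ns fa G0 o0 Wc hc Gp); last first.
    by move=> e; apply: (near_apart fg _ n0 j0 (i := i)); [left|lia].
  rewrite -(btw_transl (axrot g j)) -(dir_transl (axrot g j)) -(dir_transl (axrot g j) _ x).
  have -> : axrot g j * (axrot g (- j)%R * 1) = 1 by rewrite mulgA -rotD addrN rot0 mulg1.
  move=> bb n1 nx; apply: alternating_dir ax bb _ _.
    move=> e; apply: n1; apply: (@mulgI _ (axrot g j)); rewrite e.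
    by rewrite mulgA -rotD addrN rot0 mulg1.
  by move/mulgI.
Qed.

(** * How axes meet the enlarged set *)

Definition full' := full N' W'.

Lemma fresh_full' g : fresh g -> full' g.
Proof. by move=> fg; split=> [|i]; [exact: N'_rot|exact: W'_on (on_axis w g i)]. Qed.

Lemma meets_full' g i : W (L g i) -> full' g.
Proof.
move=> Wi; have [[Nr Wr]|nN] := classic (full N W g).
  by split=> [|j]; left.
by apply: fresh_full'; split=> //; exists i.
Qed.

Lemma meets_W' g i j : W (L g i) -> W' (L g j).
Proof. by move=> /meets_full'[]. Qed.

Lemma meets_N' g i : W (L g i) -> N' (axrot g 1).
Proof. by move=> /meets_full'[]. Qed.

Lemma full'_transl y g : N' y -> full' g -> full' (y * g).
Proof.
move=> Ny [Nr Wr]; split=> [|i]; last by rewrite -axis_transl; exact: N'_W'.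
by rewrite -rotJ; apply: N'_mul (N'_mul Ny Nr) (N'_inv Ny).
Qed.

Definition avoids g := forall y x i, N' y -> W x -> L g i <> y * x.

Lemma avoids_transl y g : N' y -> avoids g -> avoids (y * g).
Proof.
move=> Ny av z x i Nz Wx e; apply: (av (y^-1 * z) x i) => //.
  by apply: N'_mul => //; exact: N'_inv.
by rewrite -mulgA -e axis_transl mulKg.
Qed.

Lemma avoids_W g i : avoids g -> ~ W (L g i).
Proof. by move=> av Wi; apply: (av 1 (L g i) i) => //; [left; exact: (wm1 wm)|rewrite mul1g]. Qed.

Definition new_axis e := exists y h, [/\ N' y, fresh h & e = y * h].

Lemma new_axis_transl y e : N' y -> new_axis e -> new_axis (y * e).
Proof.
move=> Ny [z [h [Nz fh ->]]]; exists (y * z), h; split=> //; last by rewrite mulgA.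
exact: N'_mul.
Qed.

Lemma fresh_new h : fresh h -> new_axis h.
Proof. by move=> fh; exists 1, h; split=> //; [left; exact: (wm1 wm)|rewrite mul1g]. Qed.

(* An axis avoiding the translates of [W] cannot switch between two new axes: the
   three branches at the switching point would be pairwise of distinct types. *)
Lemma extend_chain g h h' i k : avoids g -> fresh h -> (i <= k)%R ->
  on h (L g i) -> on h (L g k) -> chain W true h' (L g (k + 1)%R) -> ~ same h' h ->
  exists e, [/\ new_axis e, on e (L g i) & on e (L g (k + 1)%R)].
Proof.
move=> av fh ik oi ok ck ns; have fh' := chain_fresh ck.
have [o1|no1] := classic (on h (L g (k + 1)%R)).
  by exists h; split=> //; exact: fresh_new.
have d1 : dist (L g (k + 1)%R) (L g k) = 1%N by rewrite dist_axis //; lia.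
have gate1 e : ~ on e (L g (k + 1)%R) -> on e (L g k) -> gate (on e) (L g (k + 1)%R) (L g k).
  move=> no o; have [z Gz] := gate_axis w_type e (L g (k + 1)%R).
  have /eqP := Gz.2 _ o; rewrite d1 => e1.
  have : dist (L g (k + 1)%R) (L e z) != 0%N.
    by apply/eqP => /dist_eq0 ez; apply: no; rewrite ez; exact: on_axis.
  move=> z0; have /dist_eq0 ez : dist (L e z) (L g k) = 0%N by lia.
  by rewrite -ez.
have ok' : on h' (L g k).
  have [/(avoids_W av)//|//] := chain_cross (fun x H => H) ck fh (not_same_sym ns) (gate1 h no1 ok).
have o1' : on h' (L g (k + 1)%R).
  have [|no] := classic (on h' (L g (k + 1)%R)); first by [].
  have [[]//|fa] := chain_far (fun x H => H) ck.
  have [m [Gm nm]] := far_not_near fh' fa; case: nm; right; exists h; split=> //.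
    exact: not_same_sym.
  by rewrite (gate_uniq Gm (gate1 h' no ok')).
have [ei|ne] := eqVneq i k.
  by exists h'; split=> //; [exact: fresh_new|rewrite ei].
have [c [Wc hc]] := fresh_helly fh fh' ok ok'.
have avc j : L h c <> L g j by move=> e; apply: (@avoids_W g j av); rewrite -e.
have [a ea] := oi; have [b eb] := ok; have [b' eb'] := ok'; have [d' ed'] := o1'.
have [c' ec'] := hc.
have bc : b <> c by move=> e; apply: (avc k); rewrite eb e.
have bc' : b' <> c' by move=> e; apply: (avc k); rewrite eb' e.
have ab : a <> b.
  move=> e; have : i = k by apply: (axis_inj w_type (g := g)); rewrite ea eb e.
  by move/eqP: ne.
have bd : `|d' - b'|%N = 1%N by rewrite -(dist_axis w_type h') -ed' -eb'.
have [h1|[h1|h1]] : ((b <= a <= c) \/ (c <= a <= b))%R \/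
    (((a <= c <= b) \/ (b <= c <= a))%R \/ ((a < b < c)%R \/ (c < b < a)%R)) by lia.
- exists h'; split=> //; first exact: fresh_new.
  by apply: (conv_on w_type ok' hc); rewrite eb ea btw_axis //; lia.
- have [j ej] : on g (L h c).
    by apply: (conv_on w_type (on_axis w g i) (on_axis w g k)); rewrite ea eb btw_axis //; lia.
  by case: (avc j).
have t1 : dir (L g k) (L g i) != dir (L g k) (L h c).
  rewrite ea eb; case: h1 => h1; first exact: dir_opp.
  by rewrite eq_sym; exact: dir_opp.
have t2 : dir (L g k) (L g i) != dir (L g k) (L g (k + 1)%R).
  by apply: dir_opp => //; move/eqP: ne; lia.
have t3 : dir (L g k) (L g (k + 1)%R) != dir (L g k) (L h c).
  have [h2|h2] : (((b' <= d' <= c') \/ (c' <= d' <= b')) \/ ((d' < b' < c') \/ (c' < b' < d')))%R by lia.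
    case: no1; apply: (conv_on w_type ok (on_axis w h c)).
    by rewrite eb' ed' ec' btw_axis //; lia.
  rewrite eb' ed' ec'; case: h2 => h2; first exact: dir_opp.
  by rewrite eq_sym; exact: dir_opp.
by move: t1 t2 t3; do 3![case: (dir _ _)].
Qed.

(** If the chain ends with a rotation about h itself, undoing it keeps the segment on h and leaves a
    chain ending on another axis, to which [extend_chain] applies. *)
Lemma extend_fresh g h i k : avoids g -> fresh h -> (i <= k)%R ->
  on h (L g i) -> on h (L g k) -> W' (L g (k + 1)%R) ->
  exists e, [/\ new_axis e, on e (L g i) & on e (L g (k + 1)%R)].
Proof.
move=> av fh ik oi ok [/(avoids_W av)//|[h' ck]].
have [s|ns] := classic (same h' h); last exact: extend_chain ck ns.
have fh' := chain_fresh ck; move ex: (L g (k + 1)%R) ck => z ck.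
case: h' z / ck ex s fh'.
- by move=> h' x _ _ o ex s _; exists h; split=> //; [exact: fresh_new|exact: on_same s o].
- move=> h' j x _ _ Wx ex s fh'; case: (av (axrot h' j) x (k + 1)%R) => //; exact: N'_rot.
move=> h' h'' j x _ _ cx ns ex s fh'.
set y := axrot h' (- j)%R; have Ny : N' y by exact: N'_rot.
have oy z : on h z -> on h (y * z) by rewrite /y (rot_same _ s); exact: on_rot.
have ns' : ~ same h'' h by move=> s2; apply: ns; case: s s2 => m -> [m' ->];
  exists (m' - m)%R; rewrite -mulgA -phi_perD; congr (_ * phi w _); lia.
have [|||e [ne oe1 oe2]] := extend_chain (avoids_transl Ny av) fh ik _ _ _ ns'.
- by rewrite -axis_transl; exact: oy.
- by rewrite -axis_transl; exact: oy.
- by rewrite -axis_transl ex mulgA /y -rotD addNr rot0 mul1g.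
exists (y^-1 * e); split.
- by apply: new_axis_transl ne; exact: N'_inv.
- by rewrite -(mulKg y (L g i)) axis_transl; exact: on_transl.
- by rewrite -ex -(mulKg y (L g _)) axis_transl; exact: on_transl.
Qed.

Lemma extend_new g e i k : avoids g -> new_axis e -> (i <= k)%R ->
  on e (L g i) -> on e (L g k) -> W' (L g (k + 1)%R) ->
  exists e', [/\ new_axis e', on e' (L g i) & on e' (L g (k + 1)%R)].
Proof.
move=> av [y [h [Ny fh ->]]] ik oi ok Wk; have Ny' := N'_inv Ny.
have oy z : on (y * h) z -> on h (y^-1 * z) by move/(on_transl y^-1); rewrite mulKg.
have [|||f [ne oe1 oe2]] := extend_fresh (avoids_transl Ny' av) fh ik.
- by rewrite -axis_transl; exact: oy.
- by rewrite -axis_transl; exact: oy.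
- by rewrite -axis_transl; exact: N'_W'.
exists (y * f); split.
- exact: new_axis_transl.
- by rewrite -(mulVKg y (L g i)) axis_transl; exact: on_transl.
- by rewrite -(mulVKg y (L g _)) axis_transl; exact: on_transl.
Qed.

Lemma W'_new g i : avoids g -> W' (L g i) -> exists e, new_axis e /\ on e (L g i).
Proof.
move=> av [/(avoids_W av)//|[h ch]].
suff [y [h0 [x [Ny fh ox e]]]] : exists y h0 x, [/\ N' y, fresh h0 \/ W x, on h0 x \/ W x & L g i = y * x].
  case: ox => [ox|Wx]; last by case: (av y x i).
  case: fh => [fh|Wx]; last by case: (av y x i).
  by exists (y * h0); split; [exists y, h0|rewrite e; exact: on_transl].
elim: {g i av} (L g i) / ch => [g x _ fg ox|g j x fg _ Wx|g h' j x fg _ cx [y [h0 [x0 [Ny f0 o0 ->]]]] _].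
- by exists 1, g, x; split; [left; exact: (wm1 wm)|left|left|rewrite mul1g].
- by exists (axrot g j), g, x; split=> //; [exact: N'_rot|right|right].
- by exists (axrot g j * y), h0, x0; split=> //; [apply: N'_mul => //; exact: N'_rot|rewrite mulgA].
Qed.

(** An axis meeting a translate of W is absorbed. Otherwise its segment in W' is followed vertex by
    vertex along a single new axis, and [overlap] gives a piece unless the two axes are the same. *)
Lemma W'_piece g : full' g \/
  forall i i' : int, (i < i')%R -> W' (L g i) -> W' (L g i') -> piece i i'.
Proof.
have [[y [x [i [Ny Wx e]]]]|no] := classic (exists y x i, [/\ N' y, W x & L g i = y * x]).
  left; rewrite -(mulVKg y g); apply: full'_transl => //; apply: (@meets_full' _ i).
  by rewrite -axis_transl e mulKg.
have av : avoids g by move=> y x i Ny Wx e; apply: no; exists y, x, i.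
have [Nr|nr] := classic (full' g); [by left|right=> i i' lt Wi Wi'].
have [e [ne oi oi']] : exists e, [/\ new_axis e, on e (L g i) & on e (L g i')].
  have [m em] : exists m : nat, i' = (i + m%:Z)%R by exists `|i' - i|%N; lia.
  rewrite {lt}em in Wi' *; elim: m Wi' => [|m IH] Wi'.
    by rewrite addr0; have [e [ne o]] := W'_new av Wi; exists e.
  have [|e [ne oi om]] := IH.
    by apply: W'_conv Wi Wi' _; rewrite btw_axis //; lia.
  have -> : (i + m.+1%:Z = i + m%:Z + 1)%R by lia.
  apply: extend_new av ne _ oi om _; first by lia.
  by move: Wi'; have -> : (i + m.+1%:Z = i + m%:Z + 1)%R by lia.
have [[j ej] [j' ej']] := (oi, oi').
case: (overlap lt ej ej') => // s; case: nr.
have [y [h [Ny fh ee]]] := ne; rewrite ee in s.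
have [Nr Wr] := full'_transl Ny (fresh_full' fh).
split=> [|k]; first by rewrite (rot_same _ s).
by have [k' ->] := on_same s (on_axis w g k).
Qed.

Lemma windmill_step : windmill N' W'.
Proof.
split.
- by left; exact: (wm1 wm).
- exact: N'_mul.
- exact: N'_inv.
- exact: W'_conv.
- exact: N'_W'.
- by left; exact: (wmW1 wm).
- exact: W'_piece.
- exact: N'_window.
Qed.

End Step.

Lemma windmill0 : windmill (eq 1) (eq 1).
Proof.
split=> //.
- by move=> x y <- <-; rewrite mulg1.
- by move=> x <-; rewrite invg1.
- move=> x y z <- <-; rewrite /btw distxx addn_eq0 => /andP[/eqP /dist_eq0 -> _] //.
- by move=> x y <- <-; rewrite mulg1.
- move=> g; right=> i i' lt ei ei'.
  have : i = i' by apply: (axis_inj w_type (g := g)); rewrite -ei -ei'.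
  by lia.
- by move=> x <-.
Qed.

Hypothesis w_onto : forall l, exists k, w k = l \/ w k = inv_letter l.

(** By [w_onto] each edge of the tree lies on an axis, so one step absorbs all edges leaving the
    ball of radius m. *)
Lemma windmill_ball (m : nat) : exists N W, windmill N W /\ forall x : fg, (size x <= m)%N -> W x.
Proof.
elim: m => [|m [N [W [wm Wm]]]].
  exists (eq 1), (eq 1); split; first exact: windmill0.
  by move=> x; rewrite leqn0 fgw_eq1 => /eqP.
exists (N' N W), (W' N W); split; first exact: windmill_step.
move=> x; case/lastP E: (fgw x) => [|u l].
  by left; apply: Wm; rewrite E.
rewrite size_rcons ltnS => le.
have ru : reduced u by have := fgwP x; rewrite E /reduced -cats1 => /cat_sorted2[].
have ex : x = of_word u * lg l by rewrite -of_word_rcons -E of_word_fgw.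
have Wu : W (of_word u) by apply: Wm; rewrite /= nf_id.
have [k [ek|ek]] := w_onto l.
- have Wk : W (L (of_word u * (phi w k)^-1) k) by rewrite /axis mulgVK.
  have := meets_W' wm (k + 1)%R Wk.
  by rewrite /axis phiS ek mulgA mulgVK -ex.
- have Wk : W (L (of_word u * (phi w (k + 1)%R)^-1) (k + 1)%R) by rewrite /axis mulgVK.
  have := meets_W' wm k Wk.
  by rewrite /axis phiS ek lgV invgM invgK !mulgA mulgVK -ex.
Qed.

(** The first premise puts x in the subgroup generated by the rotations about the axes in s. Once W
    contains a ball with all their base points, the next step contains these rotations. *)
Theorem spelling (s : seq fg) x :
  (forall N : fg -> Prop, N 1 -> (forall x y, N x -> N y -> N (x * y)) ->
     (forall x, N x -> N x^-1) -> (forall g, g \in s -> N (axrot g 1)) -> N x) ->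
  x <> 1 -> alternating x -> has_window x.
Proof.
move=> gen x1 ax; have [N [W [wm Wm]]] := windmill_ball (\max_(g <- s) size (fgw g)).
apply: (wmS (windmill_step wm)) => //; have wm' := windmill_step wm.
apply: gen => [|||g gs]; [exact: wm1 wm'|exact: wmM wm'|exact: wmV wm'|].
have Wg : W (L g 0).
  rewrite /axis phi0 mulg1; apply: Wm; exact: leq_bigmax_seq.
by have := meets_N' wm Wg.
Qed.
End Windmill.

(** * Slope letters and pieces *)

(* The letter read when a line [y = (q/p) x + i/p + 0] crosses [x = k]. *)
Definition slope_letter (p q i k : int) : letter :=
  (if (2 %| k)%Z then ga else gb, ~~ (2 %| ((k * q + i)%R %/ p)%Z)%Z).

Lemma slope_letter_type p q i k : (slope_letter p q i k).1 = if (2 %| k)%Z then ga else gb.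
Proof. by []. Qed.

Lemma divz_uniq (p x f r : int) : x = (f * p + r)%R -> (0 <= r < p)%R -> (x %/ p)%Z = f.
Proof. by move=> -> rp; rewrite divzMDl ?divz_small ?addr0 //; lia. Qed.

Lemma slope_letter_per p q i k : (p != 0)%R ->
  slope_letter p q i (k + 2 * p)%R = slope_letter p q i k.
Proof.
move=> p0; rewrite /slope_letter.
have -> : ((k + 2 * p) * q + i = (2 * q) * p + (k * q + i))%R by ring.
by rewrite divzMDl //; congr (if _ then _ else _, ~~ _); lia.
Qed.

(** For c = 0 and c = 1 the excluded k are those where k q has remainder 0 or p - 1 modulo p, the
    extreme positions at which a small shift changes the floor. *)
Definition free_of (p q c i i' : int) := forall k, (i <= k < i')%R -> ~~ (p %| (k * q + c)%R)%Z.
Definition slope_piece (p q i i' : int) := free_of p q 0 i i' \/ free_of p q 1 i i'.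

Section Slope.
Variables p q : int.
Hypothesis p_gt0 : (0 < p)%R.
Hypothesis pq_coprime : coprimez p q.

Lemma mark_ex c i : exists k, (i <= k < i + p)%R /\ (p %| (k * q + c)%R)%Z.
Proof.
have /coprimezP[[u v] /= e] := pq_coprime.
exists (i + ((- c * v - i) %% p)%Z)%R; split.
  have := modz_ge0 (- c * v - i)%R (lt0r_neq0 p_gt0).
  have := ltz_pmod (- c * v - i)%R p_gt0; lia.
have := divz_eq (- c * v - i)%R p.
set m := (_ %% p)%Z; set d := (_ %/ p)%Z => em.
have -> : ((i + m) * q + c = p * (c * u - d * q))%R.
  have -> : m = (- c * v - i - d * p)%R by rewrite em; ring.
  have : (c * (u * p + v * q) = c)%R by rewrite e mulr1.
  by lia.
exact: dvdz_mulr.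
Qed.

Lemma slope_piece_len i i' : slope_piece p q i i' -> (i' - i < p)%R.
Proof.
have aux c : free_of p q c i i' -> (i' - i < p)%R.
  move=> fr; have [//|le] : (i' - i < p \/ p <= i' - i)%R by lia.
  have [k [lk dk]] := mark_ex c i; have := fr k; rewrite dk; have -> // : (i <= k < i')%R by lia.
  by move/(_ isT).
by case; exact: aux.
Qed.

Lemma slope_piece_sub i i' j j' :
  slope_piece p q i i' -> (i <= j)%R -> (j' <= i')%R -> slope_piece p q j j'.
Proof. by move=> [f|f] h1 h2; [left|right] => k hk; apply: f; lia. Qed.

Lemma slope_piece_shift i i' m :
  slope_piece p q i i' -> slope_piece p q (i + 2 * p * m)%R (i' + 2 * p * m)%R.
Proof.
have aux c : free_of p q c i i' -> free_of p q c (i + 2 * p * m)%R (i' + 2 * p * m)%R.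
  move=> f k hk; have := f (k - 2 * p * m)%R.
  have -> : ((k - 2 * p * m) * q + c = (- 2 * m * q) * p + (k * q + c))%R by ring.
  by rewrite rpredDl ?dvdz_mull //; apply; lia.
by move=> [f|f]; [left|right]; apply: aux.
Qed.

Lemma marks i i' : ~ slope_piece p q i i' -> exists k0 kT f0 fT,
  [/\ (i <= k0 < i')%R, (i <= kT < i')%R, (k0 * q = f0 * p)%R & (kT * q = fT * p + (p - 1))%R].
Proof.
move=> np; have [f|nf] := classic (free_of p q 0 i i'); first by case: np; left.
have [f'|nf'] := classic (free_of p q 1 i i'); first by case: np; right.
have [k0 h0] := not_all_ex_not _ _ nf; have [kT hT] := not_all_ex_not _ _ nf'.
have [l0 /negP/negPn/dvdzP[f0 e0]] := imply_to_and _ _ h0.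
have [lT /negP/negPn/dvdzP[fT eT]] := imply_to_and _ _ hT.
exists k0, kT, f0, (fT - 1)%R; split=> //; first by rewrite -e0 addr0.
by rewrite mulrBl -eT; ring.
Qed.

(** Types force d to be even. Let r be d q modulo 2 p: for r >= p the parity of the floor changes at
    the mark of remainder 0, for 0 < r < p at the mark of remainder p - 1. So r = 0, and coprimality
    gives the period. *)
Lemma match_same i i' d : ~ slope_piece p q i i' ->
  (forall k, (i <= k < i')%R -> slope_letter p q 0 k = slope_letter p q 0 (k + d)%R) ->
  exists m, d = (2 * p * m)%R.
Proof.
move=> /marks[k0 [kT [f0 [fT [l0 lT e0 eT]]]]] same.
have [d' ed] : exists d' : int, d = (2 * d')%R.
  exists (d %/ 2)%Z; have := congr1 (fun l : letter => l.1) (same _ l0); rewrite /=.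
  by case: ifP; case: ifP => //; lia.
have rge := modz_ge0 (d * q)%R (d := 2 * p)%R _; have := divz_eq (d * q)%R (2 * p)%R.
have := ltz_pmod (d * q)%R (d := 2 * p)%R _.
set A := (_ %/ (2 * p))%Z; set r := (_ %% (2 * p))%Z in rge * => rlt er.
have {}rge : (0 <= r)%R by apply: rge; lia.
have {}rlt : (r < 2 * p)%R by apply: rlt; lia.
have s0 := congr1 (fun l : letter => l.2) (same _ l0).
have sT := congr1 (fun l : letter => l.2) (same _ lT).
rewrite /= !addr0 mulrDl e0 er mulzK ?gt_eqF // in s0.
rewrite /= !addr0 mulrDl eT er in sT.
rewrite (divz_uniq (f := fT) (r := (p - 1)%R)) in sT; [|by []|lia].
have r0 : r = 0%R.
  have [rp|rp] : (r < p \/ p <= r)%R by lia.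
    have [//|rp1] : (r = 0 \/ 1 <= r)%R by lia.
    rewrite (divz_uniq (x := (fT * p + (p - 1) + _)%R) (f := (fT + 1 + 2 * A)%R) (r := (r - 1)%R)) in sT; [|ring|lia].
    by move: sT; lia.
  rewrite (divz_uniq (x := (f0 * p + _)%R) (f := (f0 + 1 + 2 * A)%R) (r := (r - p)%R)) in s0; [|ring|lia].
  by move: s0; lia.
have : (p %| (d' * q)%R)%Z.
  apply/dvdzP; exists A; apply: (@mulfI _ 2%R) => //.
  by move: er; rewrite r0 ed; lia.
rewrite Gauss_dvdzl // => /dvdzP[m em]; exists m; rewrite ed em; ring.
Qed.

(** With s = 2 d' and r = d' q modulo p, the floors at k and s - k have equal parities at the mark
    of remainder 0 if 2 r < p, and at the other mark otherwise; inversion would make them differ. *)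
Lemma match_opp i i' s : ~ slope_piece p q i i' ->
  ~ (forall k, (i <= k < i')%R -> slope_letter p q 0 k = inv_letter (slope_letter p q 0 (s - k)%R)).
Proof.
move=> /marks[k0 [kT [f0 [fT [l0 lT e0 eT]]]]] opp.
have [d' ed] : exists d' : int, s = (2 * d')%R.
  exists (s %/ 2)%Z; have := congr1 (fun l : letter => l.1) (opp _ l0); rewrite /=.
  by case: ifP; case: ifP => //; lia.
have rge := modz_ge0 (d' * q)%R (d := p)%R _; have := divz_eq (d' * q)%R p.
have := ltz_pmod (d' * q)%R p_gt0.
set A := (_ %/ p)%Z; set r := (_ %% p)%Z in rge * => rlt er.
have {}rge : (0 <= r)%R by apply: rge; lia.
have s0 := congr1 (fun l : letter => l.2) (opp _ l0).
have sT := congr1 (fun l : letter => l.2) (opp _ lT).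
rewrite /= !addr0 mulrBl e0 ed -mulrA er mulzK ?gt_eqF // in s0.
rewrite /= !addr0 mulrBl eT ed -mulrA er in sT.
rewrite (divz_uniq (f := fT) (r := (p - 1)%R)) in sT; [|by []|lia].
have [rp|rp] : (2 * r < p \/ p <= 2 * r)%R by lia.
  rewrite (divz_uniq (x := (_ - f0 * p)%R) (f := (2 * A - f0)%R) (r := (2 * r)%R)) in s0; [|ring|lia].
  by move: s0; lia.
rewrite (divz_uniq (x := (_ - (fT * p + (p - 1)))%R) (f := (2 * A - fT)%R) (r := (2 * r - p + 1)%R)) in sT; [|ring|lia].
by move: sT; lia.
Qed.

Notation w := (slope_letter p q 0).

Lemma w_per k : w (k + 2 * p)%R = w k.
Proof. exact: (slope_letter_per _ _ _ (lt0r_neq0 p_gt0)). Qed.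

(** The common segment is run in the same direction, settled by [match_same], or in opposite
    directions, excluded by [match_opp]. *)
Lemma slope_overlap g h (i i' j j' : int) : (i < i')%R ->
  axis w g i = axis w h j -> axis w g i' = axis w h j' ->
  slope_piece p q i i' \/ same w (2 * p)%R g h.
Proof.
have wt := slope_letter_type p q 0.
move=> lt e e'; have [//|np] := classic (slope_piece p q i i'); [by left|right].
have dj : `|j' - j|%N = `|i' - i|%N.
  by rewrite -(dist_axis wt h) -(dist_axis wt g) -e -e'.
have [m em] : exists m : nat, i' = (i + m%:Z)%R by exists `|i' - i|%N; lia.
have cut : (phi w i)^-1 * phi w i' = (phi w j)^-1 * phi w j'.
  have -> : (phi w i)^-1 * phi w i' = (axis w g i)^-1 * axis w g i' by rewrite /axis !fgE.
  by rewrite e e' /axis !fgE.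
have [ej|ej] : (j' = j + m%:Z \/ j' = j - m%:Z)%R by lia.
  have mt (k : int) : (i <= k < i')%R -> w k = w (k + (j - i))%R.
    move=> hk; have [t et] : exists t : nat, k = (i + t%:Z)%R by exists `|k - i|%N; lia.
    have tm : (t < m)%N by lia.
    move: cut; rewrite em ej => /(congr1 fgw); rewrite !fgw_cut // => /(congr1 (fun u => nth (w 0) u t)).
    rewrite !nth_mkseq // et => ->; congr w; lia.
  have [c ec] := match_same np mt; exists c.
  apply: (@mulIg _ (phi w i)); rewrite -mulgA -(phi_perM w_per) -[LHS]/(axis w g i) e.
  by rewrite /axis; congr (_ * phi w _); lia.
case: (match_opp np (s := (i + j - 1)%R)) => k hk.
have [t et] : exists t : nat, k = (i + t%:Z)%R by exists `|k - i|%N; lia.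
have tm : (t < m)%N by lia.
have : (phi w j)^-1 * phi w j' = ((phi w j')^-1 * phi w j)^-1 by rewrite !fgE.
rewrite -cut em; have -> : j = (j' + m%:Z)%R by lia.
move=> /(congr1 fgw); rewrite fgw_inv !fgw_cut // => /(congr1 (fun u => nth (w 0) u t)).
rewrite nth_mkseq // /winv nth_rev; last by rewrite size_map size_mkseq.
rewrite size_map size_mkseq (nth_map (w 0)); last by rewrite size_mkseq; lia.
rewrite nth_mkseq ?et; last by lia.
by move=> ->; congr (inv_letter (w _)); lia.
Qed.
End Slope.

(** * Normal closures *)

Inductive ncl (t : fg) : fg -> Prop :=
  | ncl1 : ncl t 1
  | nclM x y : ncl t x -> ncl t y -> ncl t (x * y)
  | nclV x : ncl t x -> ncl t x^-1
  | ncl_gen g : ncl t (g * t * g^-1).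

Lemma nclJ t g x : ncl t x -> ncl t (g * x * g^-1).
Proof.
elim=> [|x' y _ IHx _ IHy|x' _ IH|h].
- by rewrite mulg1 mulgV; exact: ncl1.
- have -> : g * (x' * y) * g^-1 = (g * x' * g^-1) * (g * y * g^-1) by rewrite !fgE.
  exact: nclM.
- have -> : g * x'^-1 * g^-1 = (g * x' * g^-1)^-1 by rewrite !fgE.
  exact: nclV.
- have -> : g * (h * t * h^-1) * g^-1 = (g * h) * t * (g * h)^-1 by rewrite !fgE.
  exact: ncl_gen.
Qed.

Lemma nclJV t g x : ncl t (g * x * g^-1) <-> ncl t x.
Proof. by split=> [/(nclJ g^-1)|]; [rewrite !fgE|exact: nclJ]. Qed.

Lemma nclVV t x : ncl t x^-1 <-> ncl t x.
Proof. by split=> [/nclV|/nclV //]; rewrite invgK. Qed.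

(** Finitely many conjugates occur in an expression of x, which gives the list asked for by
    [spelling]; quantifying over closed predicates stands for the subgroup they generate. *)
Lemma ncl_finite t x : ncl t x -> exists s : seq fg, forall N : fg -> Prop, N 1 ->
  (forall x y, N x -> N y -> N (x * y)) -> (forall x, N x -> N x^-1) ->
  (forall g, g \in s -> N (g * t * g^-1)) -> N x.
Proof.
elim=> [|x' y _ [s1 h1] _ [s2 h2]|x' _ [s h]|g].
- by exists [::].
- exists (s1 ++ s2) => N N1 NM NV Ns.
  by apply: (NM); [apply: (h1 _ N1 NM NV)|apply: (h2 _ N1 NM NV)] => g gs; apply: Ns; rewrite mem_cat gs ?orbT.
- by exists s => N N1 NM NV Ns; apply: (NV); apply: (h _ N1 NM NV).
- by exists [:: g] => N N1 NM NV Ns; apply: Ns; rewrite inE.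
Qed.

(** * The congruence on words as a normal closure *)

Lemma eqv_ctx R u v a b : eqv R u v -> eqv R (a ++ u ++ b) (a ++ v ++ b).
Proof.
elim=> {u v} [u|u v _ IH|u v z _ IH1 _ IH2|u v x|u v].
- exact: eqv_refl.
- exact: eqv_sym.
- exact: eqv_trans IH2.
- by have := eqv_free R (a ++ u) (v ++ b) x; rewrite -!catA.
- by have := eqv_rel R (a ++ u) (v ++ b); rewrite -!catA.
Qed.

Lemma eqv_nf R u : eqv R u (nf u).
Proof.
elim: u => [|x u IH]; first exact: eqv_refl.
apply: (@eqv_trans _ _ (x :: nf u)).
  by have := eqv_ctx [:: x] [::] IH; rewrite !cats0.
rewrite [nf (x :: u)]/=; case E: (nf u) => [|y v] /=; first exact: eqv_refl.
by case: eqP => [->|_]; [exact: (eqv_free R [::])|exact: eqv_refl].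
Qed.

Lemma eqv_of_word R u v : of_word u = of_word v -> eqv R u v.
Proof.
move/(congr1 fgw) => /= e; apply: eqv_trans (eqv_nf R u) _; rewrite e.
exact: eqv_sym (eqv_nf R v).
Qed.

Lemma eqv_ncl R u v : eqv R u v <-> ncl (of_word R) ((of_word u)^-1 * of_word v).
Proof.
split.
  elim=> {u v} [u|u v _ IH|u v z _ IH1 _ IH2|u v x|u v].
  - by rewrite mulVg; exact: ncl1.
  - by have := nclV IH; rewrite !fgE.
  - by have := nclM IH1 IH2; rewrite !fgE.
  - rewrite (of_wordP (nf_cancel u x v)) mulVg; exact: ncl1.
  - have := nclV (ncl_gen (of_word R) (of_word v)^-1).
    by rewrite !of_word_cat !fgE.
have nil x : ncl (of_word R) x -> eqv R x [::].
  elim=> {u v x} [|x y _ IHx _ IHy|x _ IH|g].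
  - exact: eqv_refl.
  - apply: (@eqv_trans _ _ (x ++ y)).
      by apply: eqv_of_word; rewrite of_word_cat !of_word_fgw.
    apply: (@eqv_trans _ _ y) => //; have := eqv_ctx [::] y IHx; by rewrite /=.
  - apply: (@eqv_trans _ _ (winv x ++ x ++ [::])).
      apply: eqv_trans (eqv_sym (eqv_ctx (winv x) [::] IH)).
      by rewrite !cats0; apply: eqv_of_word; rewrite of_word_winv !of_word_fgw.
    by apply: eqv_of_word; rewrite !of_word_cat of_word_winv mulg1 mulVg.
  - apply: (@eqv_trans _ _ (g ++ R ++ winv g)).
      by apply: eqv_of_word; rewrite !of_word_cat of_word_winv !of_word_fgw mulgA.
    apply: eqv_trans (eqv_rel _ _ _) _.
    by apply: eqv_of_word; rewrite of_word_cat of_word_winv mulgV.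
move/nil => h; apply: eqv_sym; apply: (@eqv_trans _ _ (u ++ (winv u ++ v) ++ [::])).
  by apply: eqv_of_word; rewrite !of_word_cat of_word_winv mulg1 mulVKg.
apply: (@eqv_trans _ _ (u ++ [::] ++ [::])); last by rewrite !cats0; exact: eqv_refl.
apply: eqv_ctx; apply: eqv_trans h; apply: eqv_of_word.
by rewrite of_word_fgw of_word_cat of_word_winv.
Qed.

Lemma eqv_ncl1 R u : eqv R u [::] <-> ncl (of_word R) (of_word u).
Proof. by rewrite eqv_ncl mulg1 nclVV. Qed.

Lemma of_word_flatten_nseq u (n : nat) : of_word (flatten (nseq n u)) = of_word u ^+ n.
Proof. by elim: n => //= n IH; rewrite of_word_cat IH expgS. Qed.

Lemma phi_powM w T (n : nat) : (forall k : int, w (k + T)%R = w k) ->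
  phi w (T * n%:Z)%R = phi w T ^+ n.
Proof.
move=> per; elim: n => [|n IH]; first by rewrite mulr0.
have -> : (T * n.+1%:Z = T * n%:Z + T * 1)%R by lia.
rewrite addrC (phi_perM per) IH expgSr mulr1.
by rewrite -IH.
Qed.

Section Window.
Variables (p q : int) (n : nat).
Hypothesis p_gt1 : (1 < p)%R.
Hypothesis pq_coprime : coprimez p q.
Hypothesis n_ge2 : (2 <= n)%N.
Notation w := (slope_letter p q 0).

Let p_gt0 : (0 < p)%R. Proof. by lia. Qed.

Lemma ncl_window x : ncl (phi w (2 * p)%R ^+ n) x -> x <> 1 -> alternating x ->
  has_window w (2 * p)%R n%:Z (slope_piece p q) x.
Proof.
move=> /ncl_finite[s gen]; apply: spelling.
- exact: slope_letter_type.
- exact: w_per.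
- by move: p_gt1 n_ge2; clear; nia.
(* A piece is shorter than p, while M = 2 p n >= 4 p. *)
- move=> i i' _ /(slope_piece_len p_gt0 pq_coprime).
  by move: p_gt1 n_ge2; clear; nia.
- exact: slope_piece_sub.
- exact: slope_piece_shift.
- by move=> g h i i' j j'; exact: slope_overlap.
- move=> [[] e].
    exists 0%R; rewrite /slope_letter /inv_letter /=.
    by case: (~~ _); case: e; [left|right|right|left].
  exists 1%R; rewrite /slope_letter /inv_letter /=.
  by case: (~~ _); case: e; [left|right|right|left].
- move=> N N1 NM NV Ns; apply: (gen _ N1 NM NV) => g gs; have := Ns g gs.
by rewrite /axrot mulr1 (phi_powM _ (w_per q p_gt0)).
Qed.
End Window.

(** * Long common segments of two lines *)

(** The window is moved from the tree to positions in the word x; an axis run backwards shows its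
    letters inverted and in reverse order. *)
Lemma window_letters w T n piece (x : fg) (l0 : letter) :
  (forall k : int, (w k).1 = if (2 %| k)%Z then ga else gb) ->
  has_window w T n piece x -> exists A B : int, [/\ (A < B)%R, big T n piece A B &
    (exists t0 : int, forall k, (A <= k < B)%R ->
       (0 <= t0 + k < (size x)%:Z)%R /\ nth l0 x `|(t0 + k)%R|%N = w k) \/
    (exists t0 : int, forall k, (A <= k < B)%R ->
       (0 <= t0 - k < (size x)%:Z)%R /\ nth l0 x `|(t0 - k)%R|%N = inv_letter (w k))].
Proof.
move=> wt [g [i [i' [bg e]]]].
have d1 := dist_axis wt g i i'.
have t1 := dist_triangle (axis w g i) 1%g x.
have t2 := dist_triangle (axis w g i') (axis w g i) x.
have b1 : btw 1 (axis w g i) x by apply/eqP; lia.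
have b2 : btw (axis w g i) (axis w g i') x by apply/eqP; lia.
have := btw_cat b1; rewrite (btw_cat b2) invg1 !mul1g => ex.
set u := fgw (axis w g i) in ex; set v := (X in u ++ _ ++ X) in ex.
have ec : (axis w g i)^-1 * axis w g i' = (phi w i)^-1 * phi w i' by rewrite /axis !fgE.
rewrite ec in ex; case: bg => [[lt bg]|[lt bg]].
  exists i, i'; split=> //; left; exists ((size u)%:Z - i)%R => k hk.
  have ei : i' = (i + `|i' - i|%N%:Z)%R by lia.
  move: ex; rewrite {1}ei fgw_cut // => ->.
  rewrite !size_cat size_mkseq; split; first by lia.
  have -> : `|((size u)%:Z - i + k)%R|%N = (size u + `|k - i|)%N by lia.
  rewrite nth_cat ifF; last by lia.
  rewrite addKn nth_cat size_mkseq ifT; last by lia.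
  by rewrite nth_mkseq; [congr w; lia|lia].
exists i', i; split=> //; right; exists ((size u)%:Z + i - 1)%R => k hk.
have ei : i = (i' + `|i - i'|%N%:Z)%R by lia.
have ec' : (phi w i)^-1 * phi w i' = ((phi w i')^-1 * phi w i)^-1 by rewrite !fgE.
move: ex; rewrite ec' fgw_inv {1}ei fgw_cut // => ->.
rewrite !size_cat size_winv size_mkseq; split; first by lia.
have -> : `|((size u)%:Z + i - 1 - k)%R|%N = (size u + `|(i - 1 - k)%R|)%N by lia.
rewrite nth_cat ifF; last by lia.
rewrite addKn nth_cat size_winv size_mkseq ifT; last by lia.
rewrite /winv nth_rev; last by rewrite size_map size_mkseq; lia.
rewrite size_map size_mkseq (nth_map l0); last by rewrite size_mkseq; lia.
by rewrite nth_mkseq; [congr (inv_letter (w _)); lia|lia].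
Qed.

Section Bound.
Variables (p q : int) (n : nat).
Hypothesis p_gt1 : (1 < p)%R.
Hypothesis pq_coprime : coprimez p q.
Hypothesis n_ge2 : (2 <= n)%N.

Let p_gt0 : (0 < p)%R. Proof. by lia. Qed.

Lemma np_ge : (2 * p <= p * n%:Z)%R.
Proof. by move: p_gt1 n_ge2; clear; nia. Qed.

(** As p > 1, no position carries marks of both kinds, so the mark found among p consecutive
    positions is strictly later than x. *)
Lemma mark_next c c' x : (c = 0 /\ c' = 1 \/ c = 1 /\ c' = 0)%R ->
  (p %| (x * q + c)%R)%Z ->
  exists y, (x < y < x + p)%R /\ (p %| (y * q + c')%R)%Z.
Proof.
move=> cc dx; have [y [hy dy]] := mark_ex p_gt0 pq_coprime c' x; exists y; split=> //.
have [e|] : x = y \/ x <> y by lia.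
  have : (p %| (c - c')%R)%Z.
    have -> : (c - c' = (x * q + c) - (y * q + c'))%R by rewrite e; ring.
    by rewrite rpredB.
  have : ~~ (p %| 1)%Z by rewrite dvdz1; lia.
  by case: cc => -[-> ->]; rewrite ?sub0r ?subr0 ?rpredN => /negP.
by lia.
Qed.

Lemma mark_shift c x m : (p %| (x * q + c)%R)%Z -> (p %| ((x + p * m) * q + c)%R)%Z.
Proof.
have -> : ((x + p * m) * q + c = (m * q) * p + (x * q + c))%R by ring.
by move=> dx; rewrite rpredD // dvdz_mull.
Qed.

Definition far_marks (A B c c' : int) := exists x y,
  [/\ (A <= x)%R, (y < B)%R, (p * n%:Z < y - x)%R, (p %| (x * q + c)%R)%Z & (p %| (y * q + c')%R)%Z].

(** Marks recur every p positions; shifts by 2 n - 2 and 2 n - 1 times p stay below B and, as n >=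
    2, separate the marks by more than p n. *)
Lemma far_marks_from A B c c' x : (c = 0 /\ c' = 1 \/ c = 1 /\ c' = 0)%R ->
  (A <= x)%R -> (x + 2 * (p * n%:Z) - p < B)%R -> (p %| (x * q + c)%R)%Z ->
  far_marks A B c c' /\ far_marks A B c' c.
Proof.
move=> cc Ax xB dx; have [y [hy dy]] := mark_next cc dx; have := np_ge => h; split.
  exists x, (y + p * (2 * n%:Z - 2))%R; split=> //; try lia.
  exact: mark_shift.
exists y, (x + p * (2 * n%:Z - 1))%R; split=> //; try lia.
exact: mark_shift.
Qed.

Lemma big_marks A B : big (2 * p)%R n%:Z (slope_piece p q) A B ->
  far_marks A B 0 1 /\ far_marks A B 1 0.
Proof.
have c01 : (0 = 0 :> int /\ 1 = 1 :> int \/ 0 = 1 :> int /\ 1 = 0 :> int)%R by left.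
have c10 : (1 = 0 :> int /\ 0 = 1 :> int \/ 1 = 1 :> int /\ 0 = 0 :> int)%R by right.
(* The part missing from n periods has no mark of kind c, so a mark found after B - 2 p n is already
   at or beyond A. *)
have aux c x : free_of p q c (B - 2 * p * n%:Z)%R A -> (p %| (x * q + c)%R)%Z ->
    (B - 2 * p * n%:Z <= x)%R -> (A <= x)%R.
  move=> fr dx le; have [//|lt] : (A <= x \/ x < A)%R by lia.
  by have := fr x; rewrite dx => /(_ _)/negP; case=> //; lia.
case=> [le|[fr|fr]].
- have [x [hx dx]] := mark_ex p_gt0 pq_coprime 0 A.
  by apply: far_marks_from c01 _ _ dx; lia.
- have [x [hx dx]] := mark_ex p_gt0 pq_coprime 0 (B - 2 * p * n%:Z)%R.
  have Ax : (A <= x)%R by apply: (aux _ _ fr dx); lia.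
  by apply: far_marks_from c01 Ax _ dx; lia.
- have [x [hx dx]] := mark_ex p_gt0 pq_coprime 1 (B - 2 * p * n%:Z)%R.
  have Ax : (A <= x)%R by apply: (aux _ _ fr dx); lia.
  by have [|] := far_marks_from (B := B) c10 Ax _ dx; first by lia.
Qed.

Variables (c d m : int).
Hypothesis d_gt0 : (0 < d)%R.
Hypothesis c_bounds : (m * d <= c <= (m + 1) * d)%R.
Hypothesis q_bounds : (m * p <= q <= (m + 1) * p)%R.

Lemma floor_step (a b x : int) : (0 < b)%R -> (m * b <= a <= (m + 1) * b)%R ->
  ((x + a)%R %/ b)%Z = ((x %/ b)%Z + m)%R \/ ((x + a)%R %/ b)%Z = ((x %/ b)%Z + m + 1)%R.
Proof.
move=> b0 ab; have := divz_eq x b; have := ltz_pmod x b0.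
have := modz_ge0 x (lt0r_neq0 b0); set f := (x %/ b)%Z; set r := (x %% b)%Z => h1 h2 e.
have [lt|ge] : (r + a - m * b < b \/ b <= r + a - m * b)%R by lia.
  by left; apply: (divz_uniq (r := (r + a - m * b)%R)); [rewrite e; ring|lia].
by right; apply: (divz_uniq (r := (r + a - m * b - b)%R)); [rewrite e; ring|lia].
Qed.

(** Both slopes lie in [m, m + 1], so each floor grows by m or m + 1 at every step, and equal
    parities force equal increments. *)
Lemma parity_match (A B t0 i : int) :
  (forall k, (A <= k < B)%R ->
     (2 %| (((t0 + k) * c)%R %/ d)%Z)%Z = (2 %| ((k * q + i)%R %/ p)%Z)%Z) ->
  exists e, forall k, (A <= k < B)%R ->
     (((t0 + k) * c)%R %/ d)%Z = (((k * q + i)%R %/ p)%Z + e)%R.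
Proof.
move=> par; exists ((((t0 + A) * c)%R %/ d)%Z - ((A * q + i)%R %/ p)%Z)%R => k hk.
have [j ej] : exists j : nat, k = (A + j%:Z)%R by exists `|k - A|%N; lia.
rewrite ej in hk *; elim: j hk {ej} => [|j IH] hk; first by rewrite addr0; lia.
have hj : (A <= A + j%:Z < B)%R by lia.
have := IH hj; have := par _ hk; have := par _ hj.
have -> : ((t0 + (A + j.+1%:Z)) * c = (t0 + (A + j%:Z)) * c + c)%R by lia.
have -> : ((A + j.+1%:Z) * q + i = (A + j%:Z) * q + i + q)%R by lia.
have := floor_step ((t0 + (A + j%:Z)) * c)%R d_gt0 c_bounds.
have := floor_step ((A + j%:Z) * q + i)%R p_gt0 q_bounds.
move: (_ %/ d)%Z (_ %/ d)%Z (_ %/ d)%Z (_ %/ p)%Z (_ %/ p)%Z (_ %/ p)%Z.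
by clear; lia.
Qed.

(** Between marks of remainders 0 and p - 1 the rounding error drops from p d to less than d. The
    two orders of the marks bound p c - q d from above and from below. *)
Lemma parity_bound (A B t0 i : int) :
  (forall k, (A <= k < B)%R ->
     (2 %| (((t0 + k) * c)%R %/ d)%Z)%Z = (2 %| ((k * q + i)%R %/ p)%Z)%Z) ->
  far_marks A B i (i + 1)%R -> far_marks A B (i + 1)%R i ->
  (p * n%:Z * `|p * c - q * d| < d)%R.
Proof.
move=> /parity_match[e match_] [x1 [y1 [Ax1 yB1 l1 dx1 dy1]]] [x2 [y2 [Ax2 yB2 l2 dx2 dy2]]].
have np := np_ge; have fl z : (d * ((z * c)%R %/ d)%Z <= z * c < d * ((z * c)%R %/ d)%Z + d)%R.
  have := divz_eq (z * c)%R d; have := ltz_pmod (z * c)%R d_gt0.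
  have := modz_ge0 (z * c)%R (lt0r_neq0 d_gt0).
  by move: (_ %/ d)%Z (_ %% d)%Z; clear; lia.
have zero z : (p %| (z * q + i)%R)%Z -> (z * q + i = p * ((z * q + i)%R %/ p)%Z)%R.
  by move=> dz; rewrite [RHS]mulrC divzK.
have top z : (p %| (z * q + (i + 1))%R)%Z ->
    (z * q + i = p * ((z * q + i)%R %/ p)%Z + p - 1)%R.
  move=> /dvdzP[f ef]; have ez : (z * q + i = (f - 1) * p + (p - 1))%R by lia.
  by rewrite (divz_uniq ez); lia.
have b1 : ((p * c - q * d) * (y1 - x1) < d)%R.
  have hx : (A <= x1 < B)%R by move: p_gt0; lia.
  have hy : (A <= y1 < B)%R by move: p_gt0; lia.
  have f1 := fl (t0 + x1)%R; have f2 := fl (t0 + y1)%R.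
  rewrite (match_ _ hx) in f1; rewrite (match_ _ hy) in f2.
  have z1 := zero _ dx1; have z2 := top _ dy1.
  clear match_ fl zero top dx1 dy1 dx2 dy2.
  move: f1 f2 z1 z2; move: (_ %/ p)%Z (_ %/ p)%Z => g2 g1 f1 f2 z1 z2.
  have h1 : (p * (d * (g1 + e)) <= p * ((t0 + x1) * c))%R by rewrite ler_pM2l //; lia.
  have h2 : (p * ((t0 + y1) * c) <= p * (d * (g2 + e) + d - 1))%R by rewrite ler_pM2l //; lia.
  have k1 : (d * (x1 * q + i) = d * (p * g1))%R by rewrite -z1.
  have k2 : (d * (y1 * q + i) = d * (p * g2 + p - 1))%R by rewrite -z2.
  by lia.
have b2 : (- d < (p * c - q * d) * (y2 - x2))%R.
  have hx : (A <= x2 < B)%R by move: p_gt0; lia.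
  have hy : (A <= y2 < B)%R by move: p_gt0; lia.
  have f1 := fl (t0 + x2)%R; have f2 := fl (t0 + y2)%R.
  rewrite (match_ _ hx) in f1; rewrite (match_ _ hy) in f2.
  have z1 := top _ dx2; have z2 := zero _ dy2.
  clear match_ fl zero top dx1 dy1 dx2 dy2.
  move: f1 f2 z1 z2; move: (_ %/ p)%Z (_ %/ p)%Z => g2 g1 f1 f2 z1 z2.
  have h1 : (p * ((t0 + x2) * c) <= p * (d * (g1 + e) + d - 1))%R by rewrite ler_pM2l //; lia.
  have h2 : (p * (d * (g2 + e)) <= p * ((t0 + y2) * c))%R by rewrite ler_pM2l //; lia.
  have k1 : (d * (x2 * q + i) = d * (p * g1 + p - 1))%R by rewrite -z1.
  have k2 : (d * (y2 * q + i) = d * (p * g2))%R by rewrite -z2.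
  by lia.
set D := (p * c - q * d)%R in b1 b2 *.
by move: b1 b2 l1 l2 np d_gt0 p_gt0; clear; nia.
Qed.
End Bound.

(** * Strips of slope r *)

Definition slope_loop (p q i : int) : fg := phi (slope_letter p q i) (2 * p)%R.

Lemma slope_phi_per p q i k : (0 < p)%R ->
  phi (slope_letter p q i) (k + 2 * p)%R = slope_loop p q i * phi (slope_letter p q i) k.
Proof. by move=> p0; apply: phi_period => j; apply: slope_letter_per; exact: lt0r_neq0. Qed.

Lemma slope_phi_perM p q i k m : (0 < p)%R ->
  phi (slope_letter p q i) (k + 2 * p * m)%R =
  phi (slope_letter p q i) (2 * p * m)%R * phi (slope_letter p q i) k.
Proof. by move=> p0; apply: phi_perM => j; apply: slope_letter_per; exact: lt0r_neq0. Qed.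

Lemma slope_loop_shift p q i k : (0 < p)%R ->
  (phi (slope_letter p q i) k)^-1 * phi (slope_letter p q i) (k + 2 * p)%R =
  (phi (slope_letter p q i) k)^-1 * slope_loop p q i * (phi (slope_letter p q i) k)^-1^-1.
Proof. by move=> p0; rewrite slope_phi_per // !fgE. Qed.

(* The rotation by pi about a lattice point on the line exchanges the lines of
   offsets [i] and [i - 1]. *)
Lemma slope_loop_pred p q i : (0 < p)%R -> coprimez p q ->
  exists g, slope_loop p q (i - 1)%R = g * (slope_loop p q i)^-1 * g^-1.
Proof.
move=> p0 cp; have [k0 [_ /dvdzP[f ef]]] := mark_ex p0 cp i 0.
have [m em] : exists m : nat, (2 * p = m%:Z)%R by exists `|(2 * p)%R|%N; lia.
have /phi_cut_rev : forall t : nat, (t < m)%N -> slope_letter p q (i - 1)%R (k0 + 1 - 1 - t%:Z)%R =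
    inv_letter (slope_letter p q i (k0 + t%:Z)%R).
  move=> t _.
  rewrite /slope_letter /inv_letter /= negbK; congr (_, _); first by congr (if _ then _ else _); lia.
  have -> : ((k0 + t%:Z) * q + i = f * p + t%:Z * q)%R by rewrite -ef; ring.
  have -> : ((k0 + 1 - 1 - t%:Z) * q + (i - 1) = f * p + (- (t%:Z * q) - 1))%R.
    by rewrite -ef; ring.
  rewrite !divzMDl ?lt0r_neq0 //.
  have := divz_eq (t%:Z * q)%R p; have := modz_ge0 (t%:Z * q)%R (lt0r_neq0 p0).
  have := ltz_pmod (t%:Z * q)%R p0.
  set a := (_ %/ p)%Z; set b := (_ %% p)%Z => h1 h2 h3.
  rewrite (divz_uniq (x := (- _ - 1)%R) (f := (- a - 1)%R) (r := (p - 1 - b)%R)); [|by rewrite h3; ring|by lia].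
  by move: a {h1 h2 h3 b} => a; lia.
rewrite -em slope_phi_per //.
have := slope_phi_per q (i - 1)%R (k0 + 1 - 2 * p)%R p0; rewrite subrK => ->.
set A := phi _ k0; set X := slope_loop p q i; set Y := slope_loop p q (i - 1)%R.
set B := phi _ _ => e; exists (Y * B * A^-1).
have -> : Y * B * A^-1 * X^-1 * (Y * B * A^-1)^-1 = Y * B * (A^-1 * (X * A))^-1 * (Y * B)^-1.
  by rewrite !fgE.
by rewrite e !fgE.
Qed.

Lemma expVn (x : fg) (n : nat) : (x^-1) ^+ n = (x ^+ n)^-1.
Proof. by elim: n => [|n IH]; rewrite ?invg1 // expgS IH -invgM -expgSr. Qed.

Lemma expJ (g x : fg) (n : nat) : (g * x * g^-1) ^+ n = g * x ^+ n * g^-1.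
Proof. by elim: n => [|n IH]; rewrite ?mulg1 ?mulgV // !expgS IH !fgE. Qed.

(** Loops of adjacent offsets are conjugate up to inversion, by [slope_loop_pred]. *)
Lemma slope_loop_offset t p q i (n : nat) : (0 < p)%R -> coprimez p q ->
  ncl t (slope_loop p q i ^+ n) <-> ncl t (slope_loop p q 0 ^+ n).
Proof.
move=> p0 cp; have step j : ncl t (slope_loop p q j ^+ n) <-> ncl t (slope_loop p q (j - 1)%R ^+ n).
  have [g ->] := slope_loop_pred j p0 cp.
  by rewrite expJ expVn nclJV nclVV.
elim/int_ind: i => // m IH.
  have -> : m.+1%:Z = (m%:Z + 1)%R by lia.
  by rewrite -IH (step (m%:Z + 1)%R) addrK.
by rewrite -IH (step (- m%:Z)%R); have -> : (- m.+1%:Z = - m%:Z - 1)%R by lia.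
Qed.

Lemma slope_loop_offset1 t p q i : (0 < p)%R -> coprimez p q ->
  ncl t (slope_loop p q i) <-> ncl t (slope_loop p q 0).
Proof. by move=> p0 cp; have := slope_loop_offset t i 1 p0 cp; rewrite !expg1. Qed.

Definition ceilz (x D : int) : int := (- ((- x)%R %/ D)%Z)%R.

Lemma ceilz_le x D k : (0 < D)%R -> (ceilz x D <= k)%R = (x <= k * D)%R.
Proof.
move=> D0; rewrite /ceilz; have := divz_eq (- x)%R D; have := modz_ge0 (- x)%R (lt0r_neq0 D0).
have := ltz_pmod (- x)%R D0; move: (_ %/ D)%Z (_ %% D)%Z => a b h1 h2 h3.
apply/idP/idP => h; first by move: h h1 h2 h3 D0; clear; nia.
have [//|lt] : (- a <= k \/ k + 1 <= - a)%R by lia.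
by move: lt h h1 h2 h3 D0; clear; nia.
Qed.

Lemma ceilz_addM x D k : (0 < D)%R -> ceilz (x + k * D)%R D = (ceilz x D + k)%R.
Proof.
move=> D0; rewrite /ceilz; have -> : (- (x + k * D) = (- k) * D + - x)%R by ring.
by rewrite divzMDl ?lt0r_neq0 // opprD opprK addrC.
Qed.

Lemma ceilz_mul k D : (0 < D)%R -> ceilz (k * D)%R D = k.
Proof. by move=> D0; rewrite /ceilz -mulNr mulzK ?lt0r_neq0 // opprK. Qed.

Lemma ceilz0 D : ceilz 0 D = 0.
Proof. by rewrite /ceilz oppr0 div0z oppr0. Qed.

Section Zigzag.
Variables p q : int.
Hypothesis p_gt0 : (0 < p)%R.
Notation W i := (slope_letter p q i).

(* The loop crossing successively the strips of slope [q/p], where the strip [i]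
   is followed from the abscissa [ceil (i d / D)] to [ceil ((i + 1) d / D)]. *)
Fixpoint zigzag (d D : int) (m : nat) : fg :=
  if m is m'.+1 then
    zigzag d D m' * ((phi (W m'%:Z) (ceilz (m'%:Z * d)%R D))^-1 *
                     phi (W m'%:Z) (ceilz (m%:Z * d)%R D))
  else 1.

Lemma ncl_eqM t x y u v : ncl t (x^-1 * y) -> ncl t (u^-1 * v) -> ncl t ((x * u)^-1 * (y * v)).
Proof.
move=> h1 h2; have := nclM (nclJ u^-1 h1) h2.
by rewrite !fgE.
Qed.

(** Adding 2 p n e D to d moves the k-th endpoint by k n e periods, so each strip path gains n e
    periods, which amounts to a conjugate of a power of the n-th power of a loop. *)
Lemma zigzag_twist t (n : nat) (e : int) d D m : coprimez p q -> (0 < D)%R ->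
  ncl t (slope_loop p q 0 ^+ n) ->
  ncl t ((zigzag d D m)^-1 * zigzag (d + 2 * p * (n%:Z * e) * D)%R D m).
Proof.
move=> cp D0 tn; elim: m => [|m IH]; first by rewrite /= mulVg; exact: ncl1.
rewrite /=; apply: ncl_eqM IH _.
have ec (k : int) : ceilz (k * (d + 2 * p * (n%:Z * e) * D))%R D =
    (ceilz (k * d)%R D + 2 * p * (n%:Z * e * k))%R.
  by rewrite -ceilz_addM //; congr ceilz; ring.
rewrite !ec; set w := W m%:Z; set a := ceilz _ D; set b := ceilz _ D.
have -> : (b + 2 * p * (n%:Z * e * m.+1%:Z) = b + 2 * p * (n%:Z * e) + 2 * p * (n%:Z * e * m%:Z))%R.
  by rewrite -[m.+1]addn1 PoszD; ring.
rewrite !(slope_phi_perM _ _ _ (n%:Z * e * m%:Z)%R p_gt0) slope_phi_perM // -/w.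
set P := phi w (2 * p * (n%:Z * e * m%:Z))%R; set A := phi w a; set B := phi w b.
set Q := phi w (2 * p * (n%:Z * e))%R.
have -> : (A^-1 * B)^-1 * ((P * A)^-1 * (P * (Q * B))) = B^-1 * Q * B^-1^-1 by rewrite !fgE.
apply: nclJ; have tw : ncl t (phi w (2 * p * n%:Z)%R).
  rewrite phi_powM; last by move=> k; apply: slope_letter_per; exact: lt0r_neq0.
  by apply/(slope_loop_offset t m%:Z n p_gt0 cp).
have per (k : int) : w (k + 2 * p * n%:Z)%R = w k.
  by apply: (@w_perM w (2 * p)%R) => j; apply: slope_letter_per; exact: lt0r_neq0.
have pow (k : nat) : ncl t (phi w (2 * p * n%:Z * k%:Z)%R).
  by rewrite (phi_powM _ per); elim: k => [|k IHk]; [exact: ncl1|rewrite expgS; exact: nclM].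
rewrite /Q mulrA; case: e {ec P Q} => e; first exact: pow.
have := phi_perM per (Negz e) (2 * p * n%:Z * e.+1%:Z)%R.
rewrite NegzE mulrN subrr phi0 => /esym/mulg1_eq/(canRL (@invgK _)) ->.
exact: nclV.
Qed.

(** For m d <= k D < (m + 1) d the floors of (k q + m) / p and k c / d agree, so strip after strip
    the zigzag spells the line of slope c / d. *)
Lemma zigzag_pos c d m : (0 < d)%R -> (0 < p * c - q * d)%R ->
  zigzag d (p * c - q * d)%R m =
  phi (slope_letter d c 0) (ceilz (m%:Z * d)%R (p * c - q * d)%R).
Proof.
move=> d0 D0; elim: m => [|m IH]; first by rewrite mul0r ceilz0.
rewrite [LHS]/= IH; set D := (p * c - q * d)%R in D0 *.
set a := ceilz (m%:Z * d)%R D; set b := ceilz (m.+1%:Z * d)%R D.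
have ha k : (a <= k)%R = (m%:Z * d <= k * D)%R by exact: ceilz_le.
have hb k : (b <= k)%R = (m.+1%:Z * d <= k * D)%R by exact: ceilz_le.
have ab : (a <= b)%R by rewrite ha; have := hb b; rewrite lexx; lia.
have [l el] : exists l : nat, b = (a + l%:Z)%R by exists `|b - a|%N; lia.
have /phi_cut_eq : forall t : nat, (t < l)%N ->
    W m%:Z (a + t%:Z)%R = slope_letter d c 0 (a + t%:Z)%R.
  move=> t tl; set k := (a + t%:Z)%R; rewrite /slope_letter; congr (_, ~~ (_ %| _)%Z).
  have h1 : (m%:Z * d <= k * D)%R by rewrite -ha /k; lia.
  have h2 : (k * D < m.+1%:Z * d)%R by rewrite ltNge -hb -ltNge /k; lia.
  have := divz_eq (k * q + m%:Z)%R p; have := modz_ge0 (k * q + m%:Z)%R (lt0r_neq0 p_gt0).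
  have := ltz_pmod (k * q + m%:Z)%R p_gt0; set f := (_ %/ p)%Z; set r := (_ %% p)%Z => h3 h4 h5.
  apply/esym/(divz_uniq (r := (k * c - f * d)%R)); first by ring.
  have e5 : (d * (k * q + m%:Z) = d * (f * p + r))%R by rewrite h5.
  have g1 : (p * (f * d) <= p * (k * c))%R.
    have : (0 <= d * r)%R by rewrite mulr_ge0 //; lia.
    by move: h1 e5; rewrite /D; clear; lia.
  have g2 : (p * (k * c) < p * (f * d + d))%R.
    have : (d * r <= d * (p - 1))%R by rewrite ler_pM2l //; lia.
    by move: h2 e5; rewrite /D; clear; lia.
  by rewrite ler_pM2l // in g1; rewrite ltr_pM2l // in g2; lia.
by rewrite -el => ->; rewrite mulVKg.
Qed.

(** With d < 0 the strips are followed backwards and the half-open ranges of k close at the other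
    end, which the offset - 1 records. *)
Lemma zigzag_neg c d m : (d < 0)%R -> (0 < p * c - q * d)%R ->
  zigzag d (p * c - q * d)%R m =
  phi (slope_letter (- d)%R (- c)%R (- 1)%R) (ceilz (m%:Z * d)%R (p * c - q * d)%R).
Proof.
move=> d0 D0; elim: m => [|m IH]; first by rewrite mul0r ceilz0.
rewrite [LHS]/= IH; set D := (p * c - q * d)%R in D0 *.
set a := ceilz (m%:Z * d)%R D; set b := ceilz (m.+1%:Z * d)%R D.
have ha k : (a <= k)%R = (m%:Z * d <= k * D)%R by exact: ceilz_le.
have hb k : (b <= k)%R = (m.+1%:Z * d <= k * D)%R by exact: ceilz_le.
have ba : (b <= a)%R by rewrite hb; have := ha a; rewrite lexx; lia.
have [l el] : exists l : nat, a = (b + l%:Z)%R by exists `|b - a|%N; lia.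
have /phi_cut_eq : forall t : nat, (t < l)%N ->
    W m%:Z (b + t%:Z)%R = slope_letter (- d)%R (- c)%R (- 1)%R (b + t%:Z)%R.
  move=> t tl; set k := (b + t%:Z)%R; rewrite /slope_letter; congr (_, ~~ (_ %| _)%Z).
  have h1 : (m.+1%:Z * d <= k * D)%R by rewrite -hb /k; lia.
  have h2 : (k * D < m%:Z * d)%R by rewrite ltNge -ha -ltNge /k; lia.
  have := divz_eq (k * q + m%:Z)%R p; have := modz_ge0 (k * q + m%:Z)%R (lt0r_neq0 p_gt0).
  have := ltz_pmod (k * q + m%:Z)%R p_gt0; set f := (_ %/ p)%Z; set r := (_ %% p)%Z => h3 h4 h5.
  apply/esym/(divz_uniq (r := (- (k * c) - 1 + f * d)%R)); first by ring.
  have e5 : (d * (k * q + m%:Z) = d * (f * p + r))%R by rewrite h5.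
  have g1 : (p * (k * c) < p * (f * d))%R.
    have : (d * r <= 0)%R by rewrite mulr_le0_ge0 //; lia.
    by move: h2 e5; rewrite /D; clear; lia.
  have g2 : (p * (f * d + d) <= p * (k * c))%R.
    have : (d * (p - 1) <= d * r)%R by rewrite ler_nM2l //; lia.
    by move: h1 e5; rewrite /D; clear; lia.
  by rewrite ltr_pM2l // in g1; rewrite ler_pM2l // in g2; lia.
rewrite -el => e; have -> : (phi (W m%:Z) a)^-1 * phi (W m%:Z) b = ((phi (W m%:Z) b)^-1 * phi (W m%:Z) a)^-1.
  by rewrite !fgE.
by rewrite e !fgE.
Qed.
End Zigzag.

(** * Loops and the Farey action *)

(** Homogeneous coordinates on the extended rationals; negative d is allowed so that the linear
    action needs no normalisation of signs. *)
Definition slope_of (c d : int) : option rat :=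
  if (d == 0)%R then None else Some (c%:~R / d%:~R)%R.

Lemma slope_ofN c d : slope_of (- c)%R (- d)%R = slope_of c d.
Proof. by rewrite /slope_of oppr_eq0; case: eqP => // _; rewrite !mulrNz invrN mulrNN. Qed.

Lemma intq_eq0 (d : int) : ((d%:~R : rat) == 0)%R = (d == 0)%R.
Proof. exact: intr_eq0. Qed.

Lemma denq_slope c d : (0 < d)%R -> coprimez c d -> denq (c%:~R / d%:~R)%R = d.
Proof. by move=> d0 cd; rewrite coprimeq_den // gt_eqF // gtr0_norm. Qed.

Lemma numq_slope c d : (0 < d)%R -> coprimez c d -> numq (c%:~R / d%:~R)%R = c.
Proof. by move=> d0 cd; rewrite coprimeq_num // gtr0_sg // mul1r. Qed.

Lemma alpha_slope c d : (0 < d)%R -> coprimez c d ->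
  alpha (slope_of c d) = mkseq (fun k => slope_letter d c 0 k%:Z) `|(2 * d)%R|%N.
Proof.
move=> d0 cd; rewrite /slope_of gt_eqF // /alpha denq_slope // numq_slope // abszM /=.
apply: eq_map => k; rewrite /slope_letter addr0; congr (_, _).
by rewrite dvdzE /= dvdn2; case: (odd k).
Qed.

Lemma of_word_alpha c d : (0 < d)%R -> coprimez c d ->
  of_word (alpha (slope_of c d)) = slope_loop d c 0.
Proof. by move=> d0 cd; rewrite alpha_slope // /slope_loop; case: d d0 {cd} => //= d; rewrite -mul2n. Qed.

Lemma slope_ofP s : exists c d, [/\ (0 <= d)%R, coprimez c d & s = slope_of c d].
Proof.
case: s => [x|]; last by exists 1%R, 0%R.
exists (numq x), (denq x); split.
- exact: denq_ge0.
- exact: coprime_num_den.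
- by rewrite /slope_of denq_eq0 divq_num_den.
Qed.

Lemma mob_slope A B C E c d : coprimez c d ->
  mob A B C E (slope_of c d) = slope_of (A * c + B * d)%R (C * c + E * d)%R.
Proof.
move=> cd; rewrite {1}/slope_of; case: eqP => [d0|/eqP d0].
  have c0 : (c != 0)%R by apply/eqP => c0; move: cd; rewrite c0 d0.
  rewrite d0 !mulr0 !addr0 /mob /slope_of mulf_eq0 (negPf c0) orbF.
  case: eqP => // _; congr Some; rewrite !intrM invfM mulrACA divff ?mulr1 //.
  by rewrite intq_eq0.
have d0' : (d%:~R != 0 :> rat)%R by rewrite intq_eq0.
rewrite /mob /slope_of -(intq_eq0 (C * c + E * d)) !intrD !intrM.
have -> : (C%:~R * (c%:~R / d%:~R) + E%:~R = (C%:~R * c%:~R + E%:~R * d%:~R) / d%:~R :> rat)%R.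
  by field.
rewrite mulf_eq0 invr_eq0 (negPf d0') orbF; case: eqP => // /eqP e0; congr Some.
by field; rewrite d0' e0.
Qed.

Lemma refl_slope k c d : coprimez c d -> farey_refl k (slope_of c d) = slope_of (2 * k * d - c)%R d.
Proof. by move=> cd; rewrite /farey_refl mob_slope //; congr slope_of; ring. Qed.

(** In homogeneous coordinates the parabolic map is a transvection along (q, p), and it preserves p
    c - q d. *)
Lemma parab_slope r m c d : coprimez c d -> parab r m (slope_of c d) =
  slope_of (c - m * numq r * (denq r * c - numq r * d))%R
       (d - m * denq r * (denq r * c - numq r * d))%R.
Proof. by move=> cd; rewrite /parab mob_slope //; congr slope_of; ring. Qed.

Definition trivial_loop (t : fg) (s : option rat) : Prop := ncl t (of_word (alpha s)).

Lemma trivial_slope t c d : (0 < d)%R -> coprimez c d ->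
  trivial_loop t (slope_of c d) <-> ncl t (slope_loop d c 0).
Proof. by move=> d0 cd; rewrite /trivial_loop of_word_alpha. Qed.

(** With D = p c - q d, the zigzag over 2 D strips ends at abscissa 2 D d / D = 2 d, one period of
    the loop. For d < 0 it spells an inverse loop of another offset, and for d = 0 it does not
    move. *)
Lemma trivial_zigzag t p q c d : (0 < p)%R -> coprimez c d -> (0 < p * c - q * d)%R ->
  trivial_loop t (slope_of c d) <->
  ncl t (zigzag p q d (p * c - q * d)%R `|(2 * (p * c - q * d))%R|%N).
Proof.
move=> p0 cd D0; set m := `|_|%N.
have em : (m%:Z = 2 * (p * c - q * d))%R by rewrite /m; lia.
have cm : ceilz (m%:Z * d)%R (p * c - q * d)%R = (2 * d)%R.
  by rewrite em (_ : (_ * d = (2 * d) * (p * c - q * d))%R) ?ceilz_mul //; ring.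
have [d0|[d0|d0]] : (0 < d \/ d < 0 \/ d = 0)%R by lia.
- by rewrite trivial_slope // zigzag_pos // cm.
- have nd : (0 < - d)%R by lia.
  have ncd : coprimez (- c)%R (- d)%R by rewrite coprimeNz coprimezN.
  rewrite zigzag_neg // cm -slope_ofN trivial_slope // -(slope_loop_offset1 t (- 1)%R) //; last by rewrite coprimez_sym.
  have := slope_phi_per (- c)%R (- 1)%R (2 * d)%R nd.
  have -> : (2 * d + 2 * - d = 0)%R by ring.
  by rewrite phi0 => /esym/mulg1_eq <-; rewrite nclVV.
- rewrite d0 /slope_of eqxx /trivial_loop; split=> _; last exact: ncl1.
  suff -> : forall k, zigzag p q 0 (p * c - q * 0)%R k = 1 by exact: ncl1.
  by elim=> // k IH; rewrite -[LHS]/(zigzag p q 0 _ k * _) IH !mulr0 ceilz0 mul1g mulVg.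
Qed.

Lemma coprime_twist p q c d k : coprimez c d ->
  coprimez (c + k * q * (p * c - q * d))%R (d + k * p * (p * c - q * d))%R.
Proof.
case/coprimezP=> [[u v] /= e]; apply/coprimezP.
(* The Bezout coefficients of (c, d) times the inverse of the twist matrix. *)
exists (u * (1 - k * p * q) - v * k * p ^+ 2, u * k * q ^+ 2 + v * (1 + k * p * q))%R.
by rewrite /= -[RHS]e; ring.
Qed.

(** The twist preserves p c - q d, so both zigzags cross the same number of strips and
    [zigzag_twist] compares them. *)
Lemma trivial_twist t p q c d (n : nat) e : (0 < p)%R -> coprimez p q -> coprimez c d ->
  ncl t (slope_loop p q 0 ^+ n) -> trivial_loop t (slope_of c d) ->
  trivial_loop t (slope_of (c + 2 * (n%:Z * e) * q * (p * c - q * d))%R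
                       (d + 2 * (n%:Z * e) * p * (p * c - q * d))%R).
Proof.
move=> p0 pq; wlog D0 : c d / (0 < p * c - q * d)%R => [hw|] cd tn.
  have [D0|[D0|D0]] : (0 < p * c - q * d \/ p * c - q * d < 0 \/ p * c - q * d = 0)%R by lia.
  - exact: hw.
  - rewrite -[X in X -> _]/(trivial_loop t _) -slope_ofN => tr.
    have := hw (- c)%R (- d)%R; rewrite coprimeNz coprimezN => /(_ _ cd tn tr).
    rewrite -slope_ofN; set C := (- (- c + _))%R; set E := (- (- d + _))%R.
    have -> : C = (c + 2 * (n%:Z * e) * q * (p * c - q * d))%R by rewrite /C; ring.
    have -> : E = (d + 2 * (n%:Z * e) * p * (p * c - q * d))%R by rewrite /E; ring.
    by apply; lia.
  - by rewrite D0 !mulr0 !addr0.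
rewrite (trivial_zigzag t p0 cd D0).
have cd' := coprime_twist p q (2 * (n%:Z * e))%R cd.
set c' := (c + _)%R in cd' *; set d' := (d + _)%R in cd' *.
have eD : (p * c' - q * d' = p * c - q * d)%R by rewrite /c' /d'; ring.
rewrite (trivial_zigzag t (q := q) p0 cd') eD //.
have -> : d' = (d + 2 * p * (n%:Z * e) * (p * c - q * d))%R by rewrite /d'; ring.
set N := `|_|%N => z; have := zigzag_twist p0 e d N pq D0 tn.
by move=> h; have := nclM z h; rewrite mulVKg.
Qed.

(** With offset d - 1 the floor for slope c / d becomes the ceiling of j c / d, and the reflected
    slope gives 2 k j minus this ceiling: equal parities, hence the same word. *)
Lemma trivial_refl t k s : trivial_loop t s -> trivial_loop t (farey_refl k s).
Proof.
have [c [d [d0 cd ->]]] := slope_ofP s; rewrite refl_slope //.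
have [e|dp] : (d = 0 \/ 0 < d)%R by lia.
  by rewrite e /slope_of eqxx.
have cd' : coprimez (2 * k * d - c)%R d.
  move: cd => /coprimezP[[u v] /= e]; apply/coprimezP; exists (- u, v + 2 * k * u)%R.
  by rewrite -[RHS]e /=; ring.
rewrite !trivial_slope // -(slope_loop_offset1 t (d - 1)%R dp); last by rewrite coprimez_sym.
rewrite /slope_loop (@phi_eq _ (slope_letter d (2 * k * d - c) 0)%R) // => j.
rewrite /slope_letter; congr (_, ~~ _).
have := divz_eq (j * c)%R d; have := modz_ge0 (j * c)%R (lt0r_neq0 dp).
have := ltz_pmod (j * c)%R dp; set f := (_ %/ d)%Z; set b := (_ %% d)%Z => h1 h2 h3.
have [b0|b0] : (b = 0 \/ 1 <= b)%R by lia.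
  rewrite (divz_uniq (f := f) (r := (d - 1)%R)); [|by rewrite h3 b0; ring|lia].
  rewrite (divz_uniq (x := (j * _ + 0)%R) (f := (2 * k * j - f)%R) (r := 0%R)); [|by rewrite mulrBr h3 b0; ring|lia].
  by move: f {h1 h2 h3 b0 b} => f; lia.
rewrite (divz_uniq (f := (f + 1)%R) (r := (b - 1)%R)); [|by rewrite h3; ring|lia].
rewrite (divz_uniq (x := (j * _ + 0)%R) (f := (2 * k * j - f - 1)%R) (r := (d - b)%R)); [|by rewrite mulrBr h3; ring|lia].
by move: f {h1 h2 h3 b0 b} => f; lia.
Qed.

(** * Descent *)

Section Nontrivial.
Variables (p q : int) (n : nat) (c d m : int).
Hypothesis p_gt1 : (1 < p)%R.
Hypothesis pq_coprime : coprimez p q.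
Hypothesis n_ge2 : (2 <= n)%N.
Hypothesis d_gt0 : (0 < d)%R.
Hypothesis cd_coprime : coprimez c d.
Hypothesis c_bounds : (m * d <= c <= (m + 1) * d)%R.
Hypothesis q_bounds : (m * p <= q <= (m + 1) * p)%R.

(** [parity_bound] applied to the window gives the closeness; the second inequality holds because n
    periods less a piece must fit in a word of length 2 d. *)
Lemma trivial_close : ncl (slope_loop p q 0 ^+ n) (slope_loop d c 0) ->
  (p * n%:Z * `|p * c - q * d| < d)%R /\ (2 * (p * n%:Z) - p < 2 * d)%R.
Proof.
have p_gt0 : (0 < p)%R by lia.
have [l el] : exists l : nat, (2 * d = l%:Z)%R by exists `|(2 * d)%R|%N; lia.
have em : mkseq (fun t : nat => slope_letter d c 0 (0 + t%:Z)%R) l =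
    mkseq (fun t => slope_letter d c 0 t%:Z) l by apply: eq_map => t; rewrite add0r.
have ex : fgw (slope_loop d c 0) = mkseq (fun t => slope_letter d c 0 t%:Z) l.
  have := fgw_cut (slope_letter_type d c 0) 0 l; rewrite phi0 invg1 mul1g add0r -el => ->; exact: em.
move=> tx; have /window_letters : has_window (slope_letter p q 0) (2 * p)%R n%:Z
    (slope_piece p q) (slope_loop d c 0).
  apply: ncl_window => //.
    by move=> e; move: ex; rewrite e => /(congr1 size); rewrite size_mkseq /=; lia.
  have := alternating_cut (slope_letter_type d c 0) 0 l; by rewrite em ex.
move/(_ (ga, true) (slope_letter_type p q 0)) => [A [B [AB bg win]]].
have [mk1 mk2] := big_marks p_gt1 pq_coprime n_ge2 bg.
have np := np_ge p_gt1 n_ge2.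
have len : (B - A <= 2 * d)%R.
  have hA : (A <= A < B)%R by lia.
  have hB : (A <= B - 1 < B)%R by lia.
  by case: win => -[t0 h]; have [h1 _] := h _ hA; have [h2 _] := h _ hB;
    move: h1 h2; rewrite ex size_mkseq; lia.
split; last first.
  case: bg => [|/(slope_piece_len p_gt0 pq_coprime)]; lia.
have nthx (k : int) : (0 <= k < l%:Z)%R -> nth (ga, true) (fgw (slope_loop d c 0)) `|k|%N = slope_letter d c 0 k.
  by move=> hk; rewrite ex nth_mkseq; [congr slope_letter; lia|lia].
case: win => -[t0 h].
  apply: (parity_bound p_gt1 pq_coprime n_ge2 d_gt0 c_bounds q_bounds (A := A) (B := B) (t0 := t0) (i := 0)) => // k hk.
  have [h1 h2] := h k hk; rewrite nthx in h2; last by move: h1; rewrite ex size_mkseq.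
  by have /= := congr1 (fun l : letter => ~~ l.2) h2; rewrite !negbK !addr0.
have flip z a b : (p %| (z * q + a)%R)%Z -> a = (- b)%R -> (p %| (- z * q + b)%R)%Z.
  by move=> + ea; rewrite ea => dz; have -> : (- z * q + b = - (z * q - b))%R; [ring|rewrite rpredN].
(* Backward reading: k becomes - k, and the offset - 1 absorbs the inversion of letters, as the
   floor of (k q - 1) / p is - 1 minus the floor of - k q / p. *)
apply: (parity_bound p_gt1 pq_coprime n_ge2 d_gt0 c_bounds q_bounds (A := (1 - B)%R) (B := (1 - A)%R) (t0 := t0) (i := (-1)%R)).
- move=> k hk; have [|h1 h2] := h (- k)%R; first by lia.
  rewrite opprK in h1 h2; rewrite nthx in h2; last by move: h1; rewrite ex size_mkseq.
  have /= := congr1 (fun l : letter => ~~ l.2) h2; rewrite !negbK !addr0 => ->.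
  have := divz_eq (- k * q)%R p; have := modz_ge0 (- k * q)%R (lt0r_neq0 p_gt0).
  have := ltz_pmod (- k * q)%R p_gt0; set f := (_ %/ p)%Z; set b := (_ %% p)%Z => h3 h4 h5.
  have e5 : (k * q = - f * p - b)%R by move: h5; clear; lia.
  rewrite (divz_uniq (f := (- f - 1)%R) (r := (p - 1 - b)%R)); [|by rewrite e5; ring|lia].
  by move: f {h3 h4 h5 e5 b} => f; lia.
- move: mk1 => [x [y [h1 h2 h3 h4 h5]]]; exists (- y)%R, (- x)%R; split; try lia.
    by apply: (flip _ _ _ h5).
  by apply: (flip _ _ _ h4).
- move: mk2 => [x [y [h1 h2 h3 h4 h5]]]; exists (- y)%R, (- x)%R; split; try lia.
    by apply: (flip _ _ _ h5).
  by apply: (flip _ _ _ h4).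
Qed.
End Nontrivial.

Section Descent.
Variables (r : rat) (n : nat).
Hypothesis r_nonint : denq r != 1%R.
Hypothesis n_ge2 : (2 <= n)%N.
Let p := denq r.
Let q := numq r.
Let t := of_word (heckoid_rel r n).

Let p_gt1 : (1 < p)%R.
Proof. by move: r_nonint (denq_gt0 r); rewrite /p; lia. Qed.
Let p_gt0 : (0 < p)%R. Proof. by move: p_gt1; lia. Qed.
Let qp_coprime : coprimez q p. Proof. exact: coprime_num_den. Qed.
Let pq_coprime : coprimez p q. Proof. by rewrite coprimez_sym. Qed.

Lemma heckoid_relE : t = slope_loop p q 0 ^+ n.
Proof.
rewrite /t /heckoid_rel of_word_flatten_nseq; congr (_ ^+ n).
have -> : Some r = slope_of q p.
  by rewrite /slope_of ifF; [rewrite divq_num_den|exact: gt_eqF p_gt0].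
exact: of_word_alpha.
Qed.

Lemma heckoid_rel_trivial : ncl t (slope_loop p q 0 ^+ n).
Proof. by rewrite heckoid_relE -[X in ncl _ X]mul1g -[X in ncl _ X]mulg1 -{2}invg1; exact: ncl_gen. Qed.

Lemma trivial_parab s (e : int) : trivial_loop t s ->
  trivial_loop t (parab r (2 * n%:Z * e)%R s).
Proof.
have [c [d [_ cd ->]]] := slope_ofP s; rewrite parab_slope // => tr.
have := trivial_twist (- e)%R p_gt0 pq_coprime cd heckoid_rel_trivial tr.
by congr (trivial_loop t (slope_of _ _)); rewrite /p /q; ring.
Qed.

Lemma orbit_trivial s : GammaOrbitInf r n s -> trivial_loop t s.
Proof.
elim=> {s} [|k s _ IH|s _ IH|s _ IH].
- exact: ncl1.
- exact: trivial_refl.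
- by have := trivial_parab 1 IH; rewrite mulr1.
- by have := trivial_parab (- 1)%R IH; rewrite mulrN mulr1.
Qed.

Lemma parab_inv m s : parab r (- m)%R (parab r m s) = s.
Proof.
have [c [d [_ cd ->]]] := slope_ofP s; rewrite parab_slope //.
have := coprime_twist (denq r) (numq r) (- m)%R cd; rewrite !mulNr -!mulrA -!mulNr !mulrA.
move=> cd'; rewrite parab_slope; last by move: cd'; congr (is_true (coprimez _ _)); ring.
by congr slope_of; ring.
Qed.

Lemma orbit_parabK e s : (e = 1 \/ e = -1)%R ->
  GammaOrbitInf r n (parab r (2 * n%:Z * e)%R s) -> GammaOrbitInf r n s.
Proof.
move=> he o; rewrite -(parab_inv (2 * n%:Z * e)%R s); case: he o => ->.
  by rewrite mulr1; exact: orb_parV.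
by rewrite mulrN mulr1 opprK; exact: orb_par.
Qed.

Lemma normalize m c d : (0 < d)%R -> coprimez c d -> exists c1,
  [/\ coprimez c1 d, (m * d <= c1 <= (m + 1) * d)%R,
      trivial_loop t (slope_of c d) -> trivial_loop t (slope_of c1 d) &
      GammaOrbitInf r n (slope_of c1 d) -> GammaOrbitInf r n (slope_of c d)].
Proof.
move=> d0 cd; set f := (c %/ d)%Z.
have fl : (f * d <= c < f * d + d)%R.
  have := divz_eq c d; have := modz_ge0 c (lt0r_neq0 d0); have := ltz_pmod c d0.
  by rewrite -/f; move: (_ %% d)%Z f; clear; lia.
have cp k : coprimez (2 * k * d - c)%R d.
  move: cd => /coprimezP[[u v] /= e]; apply/coprimezP; exists (- u, v + 2 * k * u)%R.
  by rewrite -[RHS]e /=; ring.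
have back k c' : (c' = 2 * k * d - c)%R -> GammaOrbitInf r n (slope_of c' d) -> GammaOrbitInf r n (slope_of c d).
  move=> -> o; have := orb_refl k o; rewrite refl_slope //; congr (GammaOrbitInf r n (slope_of _ _)); ring.
have forth k : trivial_loop t (slope_of c d) -> trivial_loop t (slope_of (2 * k * d - c)%R d).
  by move=> tr; rewrite -refl_slope //; exact: trivial_refl.
(* An odd difference of integer parts is corrected by one reflection, an even one by a translation,
   which is a product of two reflections. *)
have [[k ek]|[k ek]] : (exists k, m + f + 1 = 2 * k)%R \/ (exists k, m - f = 2 * k)%R.
  have [h|h] : (2 %| (m + f + 1)%R)%Z \/ (2 %| (m - f)%R)%Z by move: f {fl} => f; lia.
    by left; exists ((m + f + 1)%R %/ 2)%Z; rewrite mulrC divzK.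
  by right; exists ((m - f)%R %/ 2)%Z; rewrite mulrC divzK.
  exists (2 * k * d - c)%R; split=> //; [|exact: forth|exact: back].
  by rewrite -ek; move: fl; clear; lia.
have e1 : (c + 2 * k * d = 2 * k * d - (2 * 0 * d - c))%R by ring.
exists (c + 2 * k * d)%R; split.
- move: cd => /coprimezP[[u v] /= e]; apply/coprimezP; exists (u, v - 2 * k * u)%R.
  by rewrite -[RHS]e /=; ring.
- by rewrite -ek; move: fl; clear; lia.
- move=> /(forth 0%R) /(trivial_refl k); rewrite refl_slope //.
  by congr (trivial_loop t (slope_of _ _)); ring.
- move=> o; apply: (back 0%R) erefl _; have := orb_refl k o; rewrite refl_slope.
    by congr (GammaOrbitInf r n (slope_of _ _)); ring.
  move: cd => /coprimezP[[u v] /= e]; apply/coprimezP; exists (u, v - 2 * k * u)%R.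
  by rewrite -[RHS]e /=; ring.
Qed.

Lemma trivial_orbit s : trivial_loop t s -> GammaOrbitInf r n s.
Proof.
have [c [d [d0 cd ->]]] := slope_ofP s; have [N] := ubnP `|d|%N.
elim: N c d d0 cd => // N IH c d d0 cd dN tr.
have [e|dp] : (d = 0 \/ 0 < d)%R by lia.
  by rewrite e /slope_of eqxx; exact: orb_inf.
set m := (q %/ p)%Z.
have mq : (m * p <= q <= (m + 1) * p)%R.
  have := divz_eq q p; have := modz_ge0 q (lt0r_neq0 p_gt0); have := ltz_pmod q p_gt0.
  by rewrite -/m; move: (_ %% p)%Z m; clear; lia.
have [c1 [cd1 mc tr1 back]] := normalize m dp cd; apply: back; move: {tr}(tr1 tr) => tr.
have [] := trivial_close p_gt1 pq_coprime n_ge2 dp cd1 mc mq.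
  by rewrite -heckoid_relE -trivial_slope.
set D := (p * c1 - q * d)%R => near long.
(* If D = 0, the slope is r itself and d = p, too short by [long]. *)
have D0 : D != 0%R.
  apply/eqP => e; have e1 : (p * c1 = q * d)%R by move: e; rewrite /D; lia.
  have h1 : (d %| p)%Z by move: (dvdz_mull q (dvdzz d)); rewrite -e1 Gauss_dvdzl // coprimez_sym.
  have h2 : (p %| d)%Z by move: (dvdz_mulr c1 (dvdzz p)); rewrite e1 Gauss_dvdzr.
  have dp' : `|d|%N = `|p|%N by apply/eqP; rewrite eqn_dvd -!dvdzE h1.
  have : d = p by move: dp' dp p_gt0; clear; lia.
  by have := np_ge p_gt1 n_ge2; lia.
(* With this sign the new denominator is d - 2 p n |D|, and 0 < p n |D| < d makes its absolute value
   smaller than d. *)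
pose e := (if 0 < D then 1 else -1)%R : int.
have he : (e = 1 \/ e = -1)%R by rewrite /e; case: ifP; [left|right].
have eD : (e * D = `|D|)%R by rewrite /e; case: ifP => h; move: D0 h; clear; lia.
apply: (orbit_parabK he); have trp := trivial_parab e tr.
move: trp; rewrite parab_slope // -/p -/q -/D.
have cd2 : coprimez (c1 - 2 * n%:Z * e * q * D)%R (d - 2 * n%:Z * e * p * D)%R.
  by have := coprime_twist p q (- (2 * n%:Z * e))%R cd1; rewrite -/D; congr (is_true (coprimez _ _)); ring.
set c2 := (c1 - _)%R in cd2 *; set d2 := (d - _)%R in cd2 *.
have small : (`|d2| < `|d|)%N.
  have -> : d2 = (d - 2 * (p * n%:Z * `|D|))%R by rewrite /d2 -eD; ring.
  have : (0 < p * n%:Z * `|D|)%R by rewrite !mulr_gt0 ?normr_gt0 //; move: n_ge2; lia.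
  by move: near dp; move: (p * n%:Z * `|D|)%R; clear; lia.
have [d2p|d2n] : (0 <= d2 \/ d2 < 0)%R by lia.
  by apply: IH => //; lia.
rewrite -slope_ofN; apply: IH; [lia|by rewrite coprimeNz coprimezN|lia].
Qed.

Lemma trivial_orbitP s : trivial_loop t s <-> GammaOrbitInf r n s.
Proof. by split; [exact: trivial_orbit|exact: orbit_trivial]. Qed.
End Descent.

(** * Signed permutations of the meridians *)

Definition signed_swap (sw e1 e2 : bool) (l : letter) : letter :=
  match l with
  | (ga, e) => (if sw then gb else ga, e (+) e1)
  | (gb, e) => (if sw then ga else gb, e (+) e2)
  end.

Lemma signed_swapV sw e1 e2 l :
  signed_swap sw e1 e2 (inv_letter l) = inv_letter (signed_swap sw e1 e2 l).
Proof. by case: l => [[] e]; rewrite /inv_letter /= addNb. Qed.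

Lemma signed_swapK e1 e2 : involutive (signed_swap false e1 e2).
Proof. by case=> [[] e] /=; rewrite addbK. Qed.

(** Adding d to c raises the floor at k by k, which inverts the letters at odd positions, those of
    b; an offset d inverts all letters. The sign choices combine these two. *)
Lemma signed_swap_slope d c (e1 e2 : bool) k : (0 < d)%R ->
  signed_swap false e1 e2 (slope_letter d c 0 k) =
  slope_letter d (if e1 == e2 then c else c + d)%R (if e1 then d else 0)%R k.
Proof.
move=> d0; have d0' := lt0r_neq0 d0.
have e c' : (k * c' + (if e1 then d else 0) = (if e1 then 1 else 0) * d + k * c')%R by case: e1; ring.
rewrite /slope_letter e divzMDl // addr0 /signed_swap.
have -> : ((k * (if e1 == e2 then c else c + d))%R %/ d)%Z =
    ((if e1 == e2 then 0 else k) + ((k * c)%R %/ d)%Z)%R.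
  case: (e1 == e2); first by rewrite add0r.
  have -> : (k * (c + d) = k * d + k * c)%R by ring.
  by rewrite divzMDl.
move: ((k * c)%R %/ d)%Z => f.
have [h|h] := boolP (2 %| k)%Z; congr (_, _); case: e1 {e}; case: e2 => /=; lia.
Qed.

(** Exchanging a and b is a shift by one position, and the offset - c compensates for the height
    gained in it. *)
Lemma signed_swap_true d c i (e1 e2 : bool) k :
  signed_swap true false false (slope_letter d c i k) = slope_letter d c (i - c)%R (k + 1)%R.
Proof.
rewrite /slope_letter; have -> : ((k + 1) * c + (i - c) = k * c + i)%R by ring.
by have [h|h] := boolP (2 %| k)%Z; rewrite /signed_swap addbF; congr (_, _);
  case: ifP => //; lia.
Qed.

Lemma signed_swap_comp sw e1 e2 l :
  signed_swap sw e1 e2 l =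
  if sw then signed_swap true false false (signed_swap false e1 e2 l) else signed_swap false e1 e2 l.
Proof. by case: sw; case: l => [[] e] //=; rewrite addbF. Qed.

Lemma of_word_slope p q i (j : int) : (0 < p)%R ->
  of_word (mkseq (fun k => slope_letter p q i (k%:Z + j)%R) `|(2 * p)%R|%N) =
  (phi (slope_letter p q i) j)^-1 * slope_loop p q i * (phi (slope_letter p q i) j)^-1^-1.
Proof.
move=> p0; rewrite -slope_loop_shift //.
have {2}-> : (2 * p = `|(2 * p)%R|%N%:Z)%R by lia.
by rewrite phi_cut; congr of_word; apply: eq_map => k; rewrite addrC.
Qed.

Lemma shift1_slope c d : (0 < d)%R -> shift1 (slope_of c d) = slope_of (c + d)%R d.
Proof.
move=> d0; rewrite /slope_of gt_eqF //= intrD mulrDl divff //.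
by rewrite intq_eq0 gt_eqF.
Qed.

Lemma trivial_signed_swap t sw e1 e2 s :
  ncl t (of_word (map (signed_swap sw e1 e2) (alpha s))) <->
  trivial_loop t (if e1 == e2 then s else shift1 s).
Proof.
have [c [d [d0 cd ->]]] := slope_ofP s.
have [e|dp] : (d = 0 \/ 0 < d)%R by lia.
  by rewrite e /slope_of eqxx /=; case: (e1 == e2); split=> _; exact: ncl1.
set c' := (if e1 == e2 then c else c + d)%R.
have cd' : coprimez c' d.
  rewrite /c'; case: ifP => // _; move: cd => /coprimezP[[u v] /= e].
  by apply/coprimezP; exists (u, v - u)%R; rewrite -[RHS]e /=; ring.
have -> : (if e1 == e2 then slope_of c d else shift1 (slope_of c d)) = slope_of c' d.
  by rewrite /c' shift1_slope //; case: ifP.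
have dc' : coprimez d c' by rewrite coprimez_sym.
rewrite trivial_slope // alpha_slope //.
set i := (if e1 then d else 0)%R.
case: sw.
- rewrite -(slope_loop_offset1 t (i - c')%R dp dc').
  rewrite (_ : map _ _ = mkseq (fun k => slope_letter d c' (i - c')%R (k%:Z + 1)%R) `|(2 * d)%R|%N).
    by rewrite of_word_slope // nclJV.
  rewrite /mkseq -map_comp; apply: eq_map => k; rewrite /comp.
  by rewrite signed_swap_comp signed_swap_slope // signed_swap_true.
- rewrite -(slope_loop_offset1 t i dp dc').
  rewrite (_ : map _ _ = mkseq (fun k => slope_letter d c' i (k%:Z + 0)%R) `|(2 * d)%R|%N).
    by rewrite of_word_slope // nclJV.
  rewrite /mkseq -map_comp; apply: eq_map => k; rewrite /comp.
  by rewrite signed_swap_comp signed_swap_slope // addr0.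
Qed.

Lemma eqv_cat S u u' v v' : eqv S u u' -> eqv S v v' -> eqv S (u ++ v) (u' ++ v').
Proof.
move=> h1 h2; apply: (@eqv_trans _ _ (u' ++ v)).
  exact: (eqv_ctx [::] v h1).
by have := eqv_ctx u' [::] h2; rewrite !cats0.
Qed.

Lemma eqv_idem S u : eqv S u (u ++ u) -> eqv S u [::].
Proof. by rewrite eqv_ncl of_word_cat mulKg eqv_ncl1. Qed.

Lemma eqv_inv_letter S l v : eqv S (l :: v) [::] -> eqv S v [:: inv_letter l].
Proof.
move=> h; apply: (@eqv_trans _ _ (inv_letter l :: l :: v)).
  apply: eqv_sym; have := eqv_free S [::] v (inv_letter l); by rewrite inv_letterK.
by have := eqv_ctx [:: inv_letter l] [::] h; rewrite !cats0.
Qed.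

Lemma is_epi_signed_swap R S f : is_epi R S f -> umpp S f ->
  exists sw e1 e2, forall w, eqv S (f w) (map (signed_swap sw e1 e2) w).
Proof.
move=> [wd mor _] um.
have f0 : eqv S (f [::]) [::] by apply: eqv_idem; exact: (mor [::] [::]).
have inv g g' e : eqv S (f [:: (g, false)]) [:: (g', e)] ->
    eqv S (f [:: (g, true)]) [:: (g', ~~ e)].
  move=> h; apply: (@eqv_inv_letter S (g', e)).
  apply: (@eqv_trans _ _ (f [:: (g, false)] ++ f [:: (g, true)])).
    by apply: eqv_sym; exact: (eqv_cat h (eqv_refl _ _)).
  apply: eqv_trans (eqv_sym (mor [:: (g, false)] [:: (g, true)])) _.
  by apply: eqv_trans f0; apply: wd; exact: (eqv_free R [::] [::] (g, false)).
suff [sw [e1 [e2 h]]] : exists sw e1 e2, forall l, eqv S (f [:: l]) [:: signed_swap sw e1 e2 l].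
  exists sw, e1, e2; elim=> [|l w IH] //.
  by apply: eqv_trans (mor [:: l] w) _; exact: (eqv_cat (h l) IH).
case: um => -[[e1 h1] [e2 h2]]; [exists false|exists true]; exists e1, e2 => -[[] []] //=;
  by rewrite ?addTb; try exact: inv.
Qed.

Lemma signed_swap_is_epi R S e1 e2 :
  eqv S (map (signed_swap false e1 e2) R) [::] ->
  is_epi R S (map (signed_swap false e1 e2)) /\ umpp S (map (signed_swap false e1 e2)).
Proof.
move=> triv; split; last first.
  by left; split; [exists e1|exists e2]; exact: eqv_refl.
split=> [u v|u v|w]; last 2 first.
- by rewrite map_cat; exact: eqv_refl.
- exists (map (signed_swap false e1 e2) w).
  by rewrite (mapK (signed_swapK e1 e2)); exact: eqv_refl.
elim=> {u v} [u|u v _ IH|u v z _ IH1 _ IH2|u v x|u v].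
- exact: eqv_refl.
- exact: eqv_sym.
- exact: eqv_trans IH2.
- by rewrite !map_cat !map_cons signed_swapV; exact: eqv_free.
- by rewrite !map_cat; have := eqv_ctx (map (signed_swap false e1 e2) u) (map (signed_swap false e1 e2) v) triv.
Qed.

Local Open Scope ring_scope.

Theorem mainTheorem2 (r : rat) (n : nat) (s : option rat) :
  denq r != 1 -> (2 <= n)%N ->
  ((exists f : word -> word,
      is_epi (link_rel s) (heckoid_rel r n) f /\ umpp (heckoid_rel r n) f)
   <-> (GammaOrbitInf r n s \/ GammaOrbitInf r n (shift1 s))).
Proof.
move=> r_nonint n_ge2; split.
- move=> [f [epi um]]; have [sw [e1 [e2 h]]] := is_epi_signed_swap epi um.
  have [wd mor _] := epi.
  have triv : eqv (heckoid_rel r n) (map (signed_swap sw e1 e2) (alpha s)) [::].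
    apply: eqv_trans (eqv_sym (h (alpha s))) _; apply: eqv_trans (h [::]).
    by apply: wd; have := eqv_rel (link_rel s) [::] [::]; rewrite /= cats0.
  move: triv; rewrite eqv_ncl1 trivial_signed_swap trivial_orbitP //.
  by case: ifP; [left|right].
(* Inverting b alone replaces s by s + 1, so e records which of the two lies in the orbit. *)
- move=> orb; have [e he] : exists e, GammaOrbitInf r n (if false == e then s else shift1 s).
    by case: orb; [exists false|exists true].
  exists (map (signed_swap false false e)); apply: signed_swap_is_epi.
  by rewrite eqv_ncl1 trivial_signed_swap trivial_orbitP.
Qed.
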